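(* Let $n\geq2$ and let $P\subset\mathbb{X}^n$ be a polyhedron, where $\mathbb{X}^n$ is $\mathbb{R}^n$, $\mathbb{S}^n$ or $\mathbb{H}^n$. If all the dihedral angles of $P$ are $\leq\pi/2$, then two facets of $P$ intersect if and only if their supporting hyperplanes intersect. Therefore $P$ is non-obtuse.
   Context: $\mathbb{H}^n=\{x\in\mathbb{R}^{n,1}:\langle x,x\rangle=-1,\ x_1>0\}$, where $\mathbb{R}^{n,1}$ is $\mathbb{R}^{n+1}$ with the Lorentzian product $-x_1y_1+x_2y_2+\cdots+x_{n+1}y_{n+1}$. A half-space of $\mathbb{X}^n$ is a set $\{x\in\mathbb{X}^n:\langle v,x\rangle\leq a\}$ with $\langle v,v\rangle=1$, where $v$ (the unit normal vector) lies in $\mathbb{R}^n,\mathbb{R}^{n+1},\mathbb{R}^{n,1}$ for $\mathbb{X}^n=\mathbb{R}^n,\mathbb{S}^n,\mathbb{H}^n$ respectively, $a\in\mathbb{R}$ in the Euclidean case and $a=0$ otherwise. A polyhedron in $\mathbb{X}^n$ is an intersection of finitely many half-spaces that has finite non-zero volume and, when $\mathbb{X}^n=\mathbb{S}^n$, lies in the interior of some half-space. A face of $P$ is a non-empty intersection of $P$ with the boundary of a half-space containing $P$; its dimension is that of the smallest subspace (totally geodesic copy of $\mathbb{X}^k$) containing it, called its supporting subspace. Facets and ridges are faces of dimension $n-1$ and $n-2$. The supporting subspace of a facet is a hyperplane. The dihedral angle of $P$ at a ridge is the interior angle in $(0,\pi)$ between the two facets containing it. Intersections are taken in $\mathbb{X}^n$: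 in the hyperbolic case, facets (or hyperplanes) of $\mathbb{H}^n$ whose closures meet only at infinity are considered disjoint, and ideal vertices are not faces. A polyhedron $P$ is the intersection of a unique minimal set of half-spaces with unit normals $v_1,\dots,v_k$; its Gram matrix is $G_{ij}=\langle v_i,v_j\rangle$. $P$ is non-obtuse if $G_{ij}\leq0$ for all $i\neq j$. *)

(* Defs.v *)
From mathcomp Require Export all_boot all_order all_algebra.
From mathcomp Require Export all_classical all_reals all_analysis.

Set Implicit Arguments.
Unset Strict Implicit.
Unset Printing Implicit Defensive.

Import Order.TTheory GRing.Theory Num.Theory.

#[global] Open Scope classical_set_scope.
#[global] Open Scope ring_scope.

Inductive space_form := Euclidean | Spherical | Hyperbolic.

(* Also the dimension of the vector space that directs (Euclidean case) or
   spans (other cases) a totally geodesic subspace of dimension [n]. *)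
Definition ambient_dim (X : space_form) (n : nat) : nat :=
  if X is Euclidean then n else n.+1.

Definition form_sign (R : realType) (X : space_form) (i : nat) : R :=
  match X, i with
  | Hyperbolic, 0%N => -1
  | _, _ => 1
  end.

Definition form (R : realType) (X : space_form) (m : nat) (u v : 'rV[R]_m) : R :=
  \sum_(i < m) form_sign R X i * (u 0 i * v 0 i).

(* Lebesgue measure on R^m, as an iterated integral of slices; the slices run
   over the first coordinate. It agrees with Lebesgue measure on Borel sets,
   the only sets on which it is used. *)
Fixpoint lebesgue_volume (R : realType) (m : nat) : set 'rV[R]_m -> \bar R :=
  match m with
  | 0%N => fun A => (\1_A 0)%:E
  | m'.+1 => fun A =>
      (\int[@lebesgue_measure R]_t
        lebesgue_volume
          [set x : 'rV[R]_m' | A (row_mx (t%:M : 'rV[R]_1) x)])%E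
  end.

Section SpaceForms.
Variables (R : realType) (X : space_form) (n : nat).
Local Notation V := 'rV[R]_(ambient_dim X n).

Definition space : set V :=
  match X return set 'rV[R]_(ambient_dim X n) with
  | Euclidean => setT
  | Spherical => [set x | form Spherical x x = 1]
  | Hyperbolic =>
      [set x : 'rV[R]_n.+1 | form Hyperbolic x x = -1 /\ 0 < x 0 0]
  end.

Definition cone_over (A : set V) : set V :=
  [set y | exists t x, [/\ 0 <= t, t <= 1, A x & y = t *: x]].

(* In polar coordinates y = r x with x in S^n or H^n, the Lebesgue measure of
   R^(n+1) is r^n dr dvol(x), both in the Euclidean and in the Lorentzian case;
   hence the cone over A has Lebesgue measure vol(A) / (n+1). *)
Definition volume (A : set V) : \bar R :=
  if X is Euclidean then lebesgue_volume A
  else (n.+1%:R%:E * lebesgue_volume (cone_over A))%E.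

(* The pair (v, a) stands for the half-space {x | <v, x> <= a}. *)
Definition halfspace_data (h : V * R) : Prop :=
  form X h.1 h.1 = 1 /\ (X <> Euclidean -> h.2 = 0).

Definition halfspace (h : V * R) : set V :=
  space `&` [set x | form X h.1 x <= h.2].

Definition halfspace_interior (h : V * R) : set V :=
  space `&` [set x | form X h.1 x < h.2].

Definition halfspace_boundary (h : V * R) : set V :=
  space `&` [set x | form X h.1 x = h.2].

Definition halfspaces_inter (H : set (V * R)) : set V :=
  space `&` \bigcap_(h in H) halfspace h.

Definition polyhedron (P : set V) : Prop :=
  [/\ exists H : set (V * R),
        [/\ finite_set H, H `<=` halfspace_data & P = halfspaces_inter H],
      (0 < volume P)%E, (volume P < +oo)%E &
      X = Spherical ->
        exists2 h, halfspace_data h & P `<=` halfspace_interior h].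

(* L is a totally geodesic copy of X^k: a k-dimensional affine subspace with
   direction W if X is Euclidean, and the intersection of X^n with the linear
   subspace W of dimension k+1 otherwise. *)
Definition geodesic_subspace (k : nat) (W : {vspace V}) (L : set V) : Prop :=
  [/\ \dim W = ambient_dim X k, L !=set0 &
      exists2 x0 : V, (X <> Euclidean -> x0 = 0) &
        L = space `&` [set x | x - x0 \in W]].

Definition supporting_subspace (F : set V) (k : nat) (W : {vspace V})
    (L : set V) : Prop :=
  [/\ geodesic_subspace k W L, F `<=` L &
      forall k' W' L', geodesic_subspace k' W' L' -> F `<=` L' -> L `<=` L'].

Definition face (P F : set V) : Prop :=
  F !=set0 /\
  exists h, [/\ halfspace_data h, P `<=` halfspace h &
                F = P `&` halfspace_boundary h].

Definition face_of_dim (P : set V) (k : nat) (F : set V) : Prop :=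
  face P F /\ exists W L, supporting_subspace F k W L.

Definition facet (P F : set V) : Prop := face_of_dim P n.-1 F.

Definition ridge (P Q : set V) : Prop := face_of_dim P n.-2 Q.

Definition supporting_hyperplane (F L : set V) : Prop :=
  exists W, supporting_subspace F n.-1 W L.

(* e is the unit vector tangent to the facet F, orthogonal to the ridge Q and
   pointing from Q into F. In the spherical and hyperbolic cases, orthogonality
   to the span of Q makes e tangent to X^n at every point of Q. *)
Definition inner_conormal (F Q : set V) (e : V) : Prop :=
  exists WF LF WQ LQ,
    [/\ supporting_subspace F n.-1 WF LF, supporting_subspace Q n.-2 WQ LQ &
     [/\ e \in WF, (forall w, w \in WQ -> form X e w = 0), form X e e = 1 &
         forall x q, F x -> Q q -> 0 <= form X e (x - q)]].

Definition dihedral_angle (P Q : set V) (theta : R) : Prop :=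
  exists F1 F2 : set V,
    [/\ facet P F1, facet P F2, F1 <> F2, Q `<=` F1 & Q `<=` F2] /\
    exists e1 e2 : V,
      [/\ inner_conormal F1 Q e1, inner_conormal F2 Q e2,
          0 < theta, theta < pi & cos theta = form X e1 e2].

Definition minimal_halfspaces (P : set V) (k : nat) (h : 'I_k -> V * R) : Prop :=
  [/\ injective h, (forall i, halfspace_data (h i)),
      P = halfspaces_inter (range h) &
      forall H, H `<=` range h -> P = halfspaces_inter H -> H = range h].

Definition gram (k : nat) (h : 'I_k -> V * R) : 'M[R]_k :=
  \matrix_(i, j) form X (h i).1 (h j).1.

(* The minimal family of a polyhedron exists and is unique up to
   reindexing. *)
Definition non_obtuse (P : set V) : Prop :=
  forall k (h : 'I_k -> V * R), minimal_halfspaces P h ->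
    forall i j, i != j -> gram h i j <= 0.

End SpaceForms.

(* Main.v *)
(** The normals v_i of the walls satisfy <v_i, v_j> <= 0 at ridges; this
    propagates to all pairs of walls in two steps.

    Walls through a common point x. By induction on the number of walls through
    x, the claim holds along the nonzero vectors of the tangent cone at x (modulo
    its lineality space). At an extremal ray w this yields
    <y, y'> <w, w> >= <y, w> <y', w> for all y, y' in the cone. Applied to a pair
    y, y' of unit vectors at maximal angle, it shows that any two vectors of the
    cone make an angle at most pi/2. If <v_i, v_j> were positive, the unit vector
    of wall i closest to wall j would make an obtuse angle with wall j.

    Arbitrary pairs. If <v_i, v_j> > 0, let x be the point of the facet i closest
    to the wall j. By Farkas' lemma v_j, or v_j - g x with g > 0 in the hyperbolic
    case, is a combination of the normals of the walls through x. By the first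
    step the coefficient of v_i is positive, so all coefficients are nonnegative,
    and pairing with a point of the facet j gives a contradiction. The hyperbolic
    minimum may be reached at an ideal point only; a horospherical slice then
    reduces to the Euclidean case. The spherical case is the first step at the
    apex of the cone over P.

    Finally, if y lies on the walls i and j and x is the point of P closest to y,
    then y - c x, for some c > 0, is a nonnegative combination of the normals of
    the walls through x. If x were off the wall i, pairing with v_i would equate a
    positive number with a nonpositive one; likewise for j. *)

Require Import Defs.
From mathcomp Require Import ring lra zify.

Set Implicit Arguments.
Unset Strict Implicit.
Unset Printing Implicit Defensive.

Import Order.TTheory GRing.Theory Num.Theory.
Import numFieldNormedType.Exports.

(** * Farkas' lemma and linear programming *)

Section Farkas.
Variable R : realType.

Definition scalar_map (W : lmodType R) (f : W -> R) :=
  forall a u w, f (a *: u + w) = a * f u + f w.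

Section ScalarMap.
Variables (W : lmodType R) (f : W -> R).
Hypothesis fL : scalar_map f.

Lemma scalar_map0 : f 0 = 0.
Proof. by have := fL 1 0 0; rewrite scaler0 addr0; lra. Qed.

Lemma scalar_mapD u w : f (u + w) = f u + f w.
Proof. by have := fL 1 u w; rewrite scale1r mul1r. Qed.

Lemma scalar_mapZ a u : f (a *: u) = a * f u.
Proof. by have := fL a u 0; rewrite addr0 scalar_map0 addr0. Qed.

Lemma scalar_mapN u : f (- u) = - f u.
Proof. by rewrite -scaleN1r scalar_mapZ mulN1r. Qed.

Lemma scalar_mapB u w : f (u - w) = f u - f w.
Proof. by rewrite scalar_mapD scalar_mapN. Qed.

End ScalarMap.

(** Induction on the constraints. If constraint [j] cannot be dropped, some [w0] satisfies all the
    others and has [g w0 > 0], hence [l j w0 > 0]; the induction hypothesis is then applied on the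
    kernel of [l j]. *)
Lemma farkas_seq (W : lmodType R) (I : eqType) (s : seq I) : uniq s ->
  forall (l : I -> W -> R) (g : W -> R),
  (forall i, scalar_map (l i)) -> scalar_map g ->
  (forall w, (forall i, i \in s -> l i w <= 0) -> g w <= 0) ->
  exists2 c : I -> R, (forall i, 0 <= c i) &
    forall w, g w = \sum_(i <- s) c i * l i w.
Proof.
elim: s => [_ l g lL gL H|j s IH /= /andP[js us] l g lL gL H].
  exists (fun=> 0) => // w; rewrite big_nil.
  have h1 := H w (fun i => ltac:(by [])).
  have := H (- w) (fun i => ltac:(by [])).
  by rewrite (scalar_mapN gL); lra.
have [H'|] := pselect (forall w, (forall i, i \in s -> l i w <= 0) -> g w <= 0).
  have [c c0 cE] := IH us l g lL gL H'.
  exists (fun i => if i == j then 0 else c i).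
    by move=> i; case: ifP.
  move=> w; rewrite big_cons eqxx mul0r add0r cE; apply: eq_big_seq => i si.
  by case: eqP => // ij; move: js; rewrite -ij si.
move=> /existsNP[w0 /not_implyP[w0s /negP]]; rewrite -ltNge => gw0.
have lj0 : 0 < l j w0.
  rewrite ltNge; apply/negP => lj; move: gw0; rewrite ltNge H //.
  by move=> i; rewrite in_cons => /predU1P[->//|]; exact: w0s.
(* [r] projects onto the kernel of [l j] along [w0]. *)
pose r w : W := w - (l j w / l j w0) *: w0.
have rL a u w : r (a *: u + w) = a *: r u + r w.
  rewrite /r lL mulrDl -mulrA scalerDl -scalerA scalerBr opprD.
  by rewrite addrACA.
have [|||c c0 cE] := IH us (fun i w => l i (r w)) (fun w => g (r w)).
- by move=> i a u w; rewrite rL lL.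
- by move=> a u w; rewrite rL gL.
- move=> w Hw; apply: H => i; rewrite in_cons => /predU1P[->|/Hw//].
  rewrite /r (scalar_mapB (lL j)) (scalar_mapZ (lL j)).
  by rewrite divfK ?subrr // gt_eqF.
(* The coefficient is forced by evaluation at [w0]; it is nonnegative because [g w0 > 0] and the
   other forms are nonpositive there. *)
pose cj := (g w0 - \sum_(i <- s) c i * l i w0) / l j w0.
exists (fun i => if i == j then cj else c i).
  move=> i; case: ifP => // _; apply: divr_ge0; last exact: ltW.
  rewrite subr_ge0.
  apply: le_trans (ltW gw0); rewrite big_seq; apply: sumr_le0 => k ks.
  by rewrite mulr_ge0_le0 // w0s.
move=> w; rewrite big_cons eqxx.
rewrite (eq_big_seq (fun i => c i * l i w)); last first.
  by move=> i si; case: eqP => // ij; move: js; rewrite -ij si.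
have := cE w; rewrite /= /r (scalar_mapB gL) (scalar_mapZ gL).
under eq_bigr => i _ do rewrite (scalar_mapB (lL _)) (scalar_mapZ (lL _))
  mulrBr mulrCA.
rewrite sumrB -mulr_sumr /cj => E; lra.
Qed.

Lemma farkas (W : lmodType R) (I : finType) (A : pred I) (l : I -> W -> R)
    (g : W -> R) :
  (forall i, scalar_map (l i)) -> scalar_map g ->
  (forall w, (forall i, A i -> l i w <= 0) -> g w <= 0) ->
  exists2 c : I -> R, (forall i, 0 <= c i) &
    forall w, g w = \sum_(i | A i) c i * l i w.
Proof.
move=> lL gL H.
have [|c c0 cE] := @farkas_seq W I (enum A) (enum_uniq _) l g lL gL.
  by move=> w Hw; apply: H => i Ai; apply: Hw; rewrite mem_enum.
by exists c => // w; rewrite cE big_enum.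
Qed.

(** Each equation is a pair of opposite inequalities, indexed by the two summands of [I + I]. *)
Lemma farkas_eq (W : lmodType R) (I : finType) (A : pred I) (l : I -> W -> R)
    (g : W -> R) :
  (forall i, scalar_map (l i)) -> scalar_map g ->
  (forall w, (forall i, A i -> l i w = 0) -> g w = 0) ->
  exists c : I -> R, forall w, g w = \sum_(i | A i) c i * l i w.
Proof.
move=> lL gL H.
pose l' (o : I + I) w := match o with inl i => l i w | inr i => - l i w end.
pose A' (o : I + I) := match o with inl i => A i | inr i => A i end.
have [||w Hw|c c0 cE] := @farkas W (I + I)%type A' l' g.
- move=> [i|i] a u w; rewrite /l' lL //; ring.
- by [].
- rewrite H // => i Ai; have /= := Hw (inl i) Ai; have /= := Hw (inr i) Ai; lra.
exists (fun i => c (inl i) - c (inr i)) => w;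
  rewrite cE big_sumType /= -big_split.
by apply: eq_bigr => i _ /=; ring.
Qed.

(** Meant for a feasible point with slacks [b] and a direction along which the constraints grow at
    rates [c]: short steps remain feasible as soon as no tight constraint grows. *)
Lemma small_step (I : finType) (b c : I -> R) :
  (forall i, 0 <= b i) -> (forall i, b i = 0 -> c i <= 0) ->
  exists2 e0, 0 < e0 & forall e i, 0 <= e <= e0 -> e * c i <= b i.
Proof.
move=> b0 bc.
suff [e0 e00 H] : exists2 e0, 0 < e0 & forall i, i \in enum I ->
    forall e, 0 <= e <= e0 -> e * c i <= b i.
  by exists e0 => // e i He; apply: H He; rewrite mem_enum.
elim: (enum I) => [|j s [e0 e00 H]]; first by exists 1.
have [e1 e10 H1] : exists2 e1, 0 < e1 &
    forall e, 0 <= e <= e1 -> e * c j <= b j.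
  have [cj|cj] := leP (c j) 0.
    exists 1 => // e /andP[e_ge0 _].
    by rewrite (le_trans _ (b0 j)) // mulr_ge0_le0.
  have bj : 0 < b j.
    by rewrite lt_neqAle b0 andbT eq_sym; apply/eqP => /bc; rewrite leNgt cj.
  exists (b j / c j); first by rewrite divr_gt0.
  by move=> e /andP[_]; rewrite ler_pdivlMr.
exists (Num.min e0 e1); first by rewrite lt_min e00.
move=> i; rewrite in_cons => is' e; rewrite le_min => /and3P[e_ge0 ee0 ee1].
case/predU1P: is' => [->|si]; first by rewrite H1 // e_ge0.
by rewrite H // e_ge0.
Qed.

Lemma first_order (a b e0 : R) : 0 < e0 ->
  (forall e, 0 < e <= e0 -> 0 <= e * a + e ^+ 2 * b) -> 0 <= a.
Proof.
move=> e00 H; rewrite leNgt; apply/negP => a0.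
have b0 : 0 <= `|b| by [].
(* The second bound keeps [e * |b|] at most half of [- a], so that the linear term wins. *)
pose e := Num.min e0 (- a / (2 * (`|b| + 1))).
have e_gt0 : 0 < e by rewrite lt_min e00 divr_gt0 //; lra.
have ee0 : e <= e0 by rewrite ge_min lexx.
have eb : e * (2 * (`|b| + 1)) <= - a.
  by rewrite -ler_pdivlMr ?ge_min ?lexx ?orbT //; lra.
have := H e; rewrite e_gt0 ee0 => /(_ isT).
have -> : e * a + e ^+ 2 * b = e * (a + e * b) by ring.
rewrite pmulr_rge0 // => ab.
have : e * b <= e * `|b| by rewrite ler_pM2l // ler_norm.
nra.
Qed.

End Farkas.

Lemma big_option (V : nmodType) (I : finType) (F : option I -> V) :
  \sum_o F o = F None + \sum_i F (Some i).
Proof.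
rewrite (bigD1 None) //=; congr (_ + _).
rewrite (reindex_omap (@Some I) id) => [|[i|]//].
by apply: eq_bigl => i; rewrite eqxx.
Qed.

Section LinearProgram.
Variables (R : realType) (W : lmodType R) (I : finType).
Variables (l : I -> W -> R) (a : I -> R) (g : W -> R).
Hypotheses (lL : forall i, scalar_map (l i)) (gL : scalar_map g).

(* Farkas' lemma is applied in W * R to the cone over the feasible set: once to
   bound g by its supremum, and once to see that a supremum which is not attained
   is not the least upper bound. *)
Lemma lp_max (x0 : W) (M : R) :
  (forall i, l i x0 <= a i) ->
  (forall x, (forall i, l i x <= a i) -> g x <= M) ->
  exists2 x, forall i, l i x <= a i &
    forall y, (forall i, l i y <= a i) -> g y <= g x.
Proof.
move=> x0F gM.
pose S := [set g x | x in [set x | forall i, l i x <= a i]].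
have S_sup : has_sup S.
  by split; [exists (g x0), x0|exists M => _ [x Fx <-]; exact: gM].
pose f := sup S.
have gf x : (forall i, l i x <= a i) -> g x <= f.
  by move=> Fx; apply: sup_upper_bound => //; exists x.
have [[x Fx fx]|noatt] := pselect (exists2 x, forall i,
  l i x <= a i & f <= g x).
  by exists x => // y /gf; move/le_trans; apply.
(* Homogenization: [(x, t)] with [t > 0] stands for the point [x / t]. The index [None] asks [g] to
   reach its supremum there. *)
pose L (o : option (option I)) (z : W * R) : R :=
  match o with
  | Some (Some i) => l i z.1 - a i * z.2
  | Some None => - z.2
  | None => f * z.2 - g z.1
  end.
have LL o : scalar_map (L o).
  move=> c [u1 u2] [w1 w2]; rewrite /L /=; case: o => [[i|]|].
  - by rewrite lL /GRing.scale /=; ring.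
  - by rewrite /GRing.scale /=; ring.
  - by rewrite gL /GRing.scale /=; ring.
have gz0 y : (forall i, l i y <= 0) -> g y <= 0.
  move=> ly; rewrite leNgt; apply/negP => gy.
  (* A recession direction increasing [g] would lead from [x0] to the value [f + 1]. *)
  pose k := (f - g x0 + 1) / g y.
  have k0 : 0 <= k.
    by apply: divr_ge0; [have := gf _ x0F; lra|exact: ltW].
  have : g (k *: y + x0) <= f.
    apply: gf => i; rewrite lL.
    have kl : k * l i y <= 0 by rewrite mulr_ge0_le0.
    by have := x0F i; lra.
  by rewrite gL /k divfK ?gt_eqF //; lra.
have [||c c0 cE] := @farkas R (W * R)%type _ predT L (fun z => z.2) LL.
  by move=> c [u1 u2] [w1 w2].
  move=> [y t] /= H.
  have t0 : 0 <= t by have := H (Some None) isT; rewrite /L /=; lra.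
  rewrite leNgt; apply/negP => tpos; apply: noatt.
  exists (t^-1 *: y) => [i|].
    rewrite (scalar_mapZ (lL i)) ler_pdivrMl //.
    by have := H (Some (Some i)) isT; rewrite /L /= mulrC; lra.
  rewrite (scalar_mapZ gL) ler_pdivlMl //.
  by have := H None isT; rewrite /L /= mulrC; lra.
pose k := c None.
have kf x : (forall i, l i x <= a i) -> 1 <= k * (f - g x).
  move=> Fx; have := cE (x, 1) => /=.
  rewrite !big_option /= /L /= !mulr1 => E.
  have : \sum_i c (Some (Some i)) * (l i x - a i * 1) <= 0.
    by apply: sumr_le0 => i _; rewrite mulr1 mulr_ge0_le0 // subr_le0.
  have := c0 (Some None); rewrite /k; lra.
have k0 : 0 < k.
  have := kf _ x0F; have := gf _ x0F; have := c0 None; rewrite -/k => h1 h2 h3.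
  by rewrite lt_neqAle h1 andbT; apply/eqP => k0; move: h3; rewrite -k0; lra.
have [_ [x Fx <-] xf] := sup_adherent (divr_gt0 ltr01 k0) S_sup.
have := kf _ Fx; rewrite -/f in xf.
have : k * (f - g x) < 1.
  by rewrite mulrC -ltr_pdivlMr //; lra.
by lra.
Qed.

End LinearProgram.

(** * The ambient bilinear form *)

Section FormTheory.
Variables (R : realType) (X : space_form) (m : nat).
Implicit Types u v w : 'rV[R]_m.
Local Notation B := (form X).

Lemma formC u v : B u v = B v u.
Proof. by apply: eq_bigr => i _; rewrite [u 0 i * _]mulrC. Qed.

Lemma form_linr u : scalar_map (B u).
Proof.
move=> a v w; rewrite /form mulr_sumr -big_split; apply: eq_bigr => i _ /=.
by rewrite !mxE; ring.
Qed.

Lemma formDr u v w : B u (v + w) = B u v + B u w.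
Proof. exact: scalar_mapD (form_linr u) _ _. Qed.
Lemma formBr u v w : B u (v - w) = B u v - B u w.
Proof. exact: scalar_mapB (form_linr u) _ _. Qed.
Lemma formNr u v : B u (- v) = - B u v.
Proof. exact: scalar_mapN (form_linr u) _. Qed.
Lemma formZr u a v : B u (a *: v) = a * B u v.
Proof. exact: scalar_mapZ (form_linr u) _ _. Qed.
Lemma form0r u : B u 0 = 0.
Proof. exact: scalar_map0 (form_linr u). Qed.
Lemma formDl u v w : B (v + w) u = B v u + B w u.
Proof. by rewrite formC formDr !(formC u). Qed.
Lemma formBl u v w : B (v - w) u = B v u - B w u.
Proof. by rewrite formC formBr !(formC u). Qed.
Lemma formNl u v : B (- v) u = - B v u.
Proof. by rewrite formC formNr formC. Qed.
Lemma formZl u a v : B (a *: v) u = a * B v u.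
Proof. by rewrite formC formZr formC. Qed.
Lemma form0l u : B 0 u = 0.
Proof. by rewrite formC form0r. Qed.

Lemma form_sumr u (I : finType) (P : pred I) (F : I -> 'rV[R]_m) :
  B u (\sum_(i | P i) F i) = \sum_(i | P i) B u (F i).
Proof. by apply: (big_morph (B u)); [exact: formDr|exact: form0r]. Qed.

Lemma form_suml u (I : finType) (P : pred I) (F : I -> 'rV[R]_m) :
  B (\sum_(i | P i) F i) u = \sum_(i | P i) B (F i) u.
Proof. by rewrite formC form_sumr; apply: eq_bigr => i _; rewrite formC. Qed.

Lemma form_sign_neq0 i : form_sign R X i != 0.
Proof. by rewrite /form_sign; case: X; case: i => *;
  rewrite ?oppr_eq0 oner_eq0. Qed.

Lemma form_delta u (i : 'I_m) : B u (delta_mx 0 i) = form_sign R X i * u 0 i.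
Proof.
rewrite /form (bigD1 i) //= mxE !eqxx mulr1 big1 ?addr0 // => j ji.
by rewrite mxE (negbTE ji) andbF !mulr0.
Qed.

Lemma form_inj u v : (forall w, B u w = B v w) -> u = v.
Proof.
move=> uv; apply/rowP => i; have := uv (delta_mx 0 i); rewrite !form_delta.
exact/mulfI/form_sign_neq0.
Qed.

Lemma form_continuous2 (T : topologicalType) (f g : T -> 'rV[R]_m) :
  continuous f -> continuous g -> continuous (fun x => B (f x) (g x)).
Proof.
move=> fc gc; apply: continuous_big => [|i _ x]; first exact: add_continuous.
have cf : (fun y => f y 0 i) y @[y --> x] --> f x 0 i.
  by apply: (@cvg_comp _ _ _ f (fun M : 'rV[R]_m => M 0 i) _ _ _ (fc x));
    exact: coord_continuous.
have cg : (fun y => g y 0 i) y @[y --> x] --> g x 0 i.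
  by apply: (@cvg_comp _ _ _ g (fun M : 'rV[R]_m => M 0 i) _ _ _ (gc x));
    exact: coord_continuous.
by apply: cvgM; [exact: cvg_cst|exact: cvgM].
Qed.

Lemma form_continuous u : continuous (B u).
Proof. by apply: (@form_continuous2 _ (fun=> u) id) => x;
  [exact: cst_continuous|apply: cvg_id]. Qed.

Lemma form_diag_continuous : continuous (fun x : 'rV[R]_m => B x x).
Proof. by apply: (@form_continuous2 _ id id) => x; apply: cvg_id. Qed.

Lemma farkas_form (I : finType) (A : pred I) (v : I -> 'rV[R]_m) u :
  (forall w, (forall i, A i -> B (v i) w <= 0) -> B u w <= 0) ->
  exists2 c : I -> R, (forall i, 0 <= c i) & u = \sum_(i | A i) c i *: v i.
Proof.
move=> H.
have [c c0 cE] := @farkas R 'rV[R]_m I A (fun i => B (v i)) (B u)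
  (fun i => form_linr (v i)) (form_linr u) H.
exists c => //; apply: form_inj => w; rewrite cE form_suml.
by apply: eq_bigr => i _; rewrite formZl.
Qed.

Lemma span_of_annihilator (I : finType) (A : pred I) (v : I -> 'rV[R]_m) u :
  (forall w, (forall i, A i -> B (v i) w = 0) -> B u w = 0) ->
  exists c : I -> R, u = \sum_(i | A i) c i *: v i.
Proof.
move=> H.
have [c cE] := @farkas_eq R 'rV[R]_m I A (fun i => B (v i)) (B u)
  (fun i => form_linr (v i)) (form_linr u) H.
exists c; apply: form_inj => w; rewrite cE form_suml.
by apply: eq_bigr => i _; rewrite formZl.
Qed.

(* If u is a Lagrange multiplier certificate relative to the wall of v j and
   points out of that wall, then it is already one without restricting to the
   wall, because the other active walls make non-obtuse angles with it. *)
Lemma release_wall (I : finType) (A : pred I) (v : I -> 'rV[R]_m) j u :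
  A j -> B (v j) (v j) = 1 ->
  (forall i, A i -> i != j -> B (v j) (v i) <= 0) -> 0 < B (v j) u ->
  (forall w, B (v j) w = 0 -> (forall i, A i -> B (v i) w <= 0) ->
    B u w <= 0) ->
  exists2 c : I -> R, (forall i, 0 <= c i) /\ 0 < c j &
    u = \sum_(i | A i) c i *: v i.
Proof.
move=> Aj vj1 obt uj H.
pose v' (o : option I) := if o is Some i then v i else - v j.
pose A' (o : option I) := if o is Some i then A i else true.
have [w Hw|c c0 cE] := @farkas_form (option I) A' v' u.
  apply: H => [|i Ai]; last exact: (Hw (Some i)).
  apply/le_anti; rewrite (Hw (Some j)) //=.
  by have := Hw None isT; rewrite /= formNl; lra.
pose e := c (Some j) - c None.
have {cE} uE : u = e *: v j + \sum_(i | A i && (i != j)) c (Some i) *: v i.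
  rewrite cE big_mkcond big_option /= -big_mkcond (bigD1 j) //= addrA.
  by congr (_ + _); rewrite scalerN scalerBl addrC.
have e0 : 0 < e.
  move: uj; rewrite uE formDr formZr vj1 mulr1 form_sumr.
  have : \sum_(i | A i && (i != j)) B (v j) (c (Some i) *: v i) <= 0.
    by apply: sumr_le0 => i /andP[Ai ij]; rewrite formZr mulr_ge0_le0 // obt.
  lra.
exists (fun i => if i == j then e else c (Some i)).
  by split=> [i|]; [case: ifP => // _; exact: ltW|rewrite eqxx].
rewrite uE [RHS](bigD1 j) //= eqxx; congr (_ + _).
by apply: eq_bigr => i /andP[_ /negbTE->].
Qed.

(** At a maximum [x] of [B (v k)] on the face of [j], a positive [B (v j) (v k)] would make [v k] a
    nonnegative combination of the normals active at [x], by [release_wall]. Pairing with [p2 - x]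
    puts [x] on the wall [k], where the local hypothesis applies. The form may be indefinite, as in
    horospherical slices. *)
Lemma lp_nonobtuse (I : finType) (v : I -> 'rV[R]_m) (a : I -> R) j k p1 p2 :
  j != k -> B (v j) (v j) = 1 ->
  (forall i, B (v i) p1 <= a i) -> B (v j) p1 = a j ->
  (forall i, B (v i) p2 <= a i) -> B (v k) p2 = a k ->
  (forall x, (forall i, B (v i) x <= a i) -> B (v j) x = a j ->
     forall i, i != j -> B (v i) x = a i -> B (v j) (v i) <= 0) ->
  B (v j) (v k) <= 0.
Proof.
move=> jk vj1 p1P p1j p2P p2k loc; rewrite leNgt; apply/negP => jk0.
(* The index [None] is the reversed inequality of [j], so that the feasible set is the face on that
   wall. *)
pose v' (o : option I) := if o is Some i then v i else - v j.
pose a' (o : option I) := if o is Some i then a i else - a j.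
have feas x : (forall o, B (v' o) x <= a' o) <->
    (forall i, B (v i) x <= a i) /\ B (v j) x = a j.
  split=> [H|[H1 H2] [i|] //=]; last by rewrite formNl H2.
  split=> [i|]; first exact: (H (Some i)).
  apply/le_anti; rewrite (H (Some j)) //=.
  by have := H None; rewrite /= formNl; lra.
have [||x xF xmax] := @lp_max R _ _ (fun o => B (v' o)) a' (B (v k))
  (fun o => form_linr (v' o)) (form_linr (v k)) p1 (a k).
- exact: (feas p1).2.
- by move=> x /(feas x).1[].
have [xP xj] := (feas x).1 xF.
have Hloc := loc _ xP xj.
have [|||||c [c0 _] vkE] := @release_wall I
  (fun i => B (v i) x == a i) v j (v k).
- exact/eqP.
- by [].
- by move=> i /eqP ix ij; exact: Hloc.
- by [].
- move=> w wj wA.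
  have [||e e0 He] := @small_step R I (fun i => a i - B (v i) x)
    (fun i => B (v i) w).
  + by move=> i; rewrite subr_ge0.
  + by move=> i /subr0_eq/esym/eqP; exact: wA.
  have := xmax (x + e *: w); rewrite formDr formZr -subr_ge0 => H.
  rewrite -(pmulr_rle0 _ e0).
  suff : forall o, B (v' o) (x + e *: w) <= a' o by move/H; lra.
  apply/feas; split=> [i|]; last by rewrite formDr formZr wj xj mulr0 addr0.
  rewrite formDr formZr; have := He e i; rewrite lexx ltW // => /(_ isT); lra.
have xk : B (v k) x = a k.
  apply/le_anti; rewrite xP /= -p2k -subr_le0 -formBr vkE form_suml.
  apply: sumr_le0 => i /eqP ix; rewrite formZl mulr_ge0_le0 // formBr ix.
  by rewrite subr_le0.
by have := Hloc k; rewrite eq_sym jk xk leNgt jk0 => /(_ isT erefl).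
Qed.

End FormTheory.

(** * Walls through a common point *)

Section Closed.
Variables (R : realType) (T : topologicalType).

Lemma closed_le_fun (f : T -> R) (a : R) :
  continuous f -> closed [set x | f x <= a].
Proof. by move=> /continuous_closedP/(_ _ (@closed_le _ a)). Qed.

Lemma closed_eq_fun (f : T -> R) (a : R) :
  continuous f -> closed [set x | f x = a].
Proof. by move=> /continuous_closedP/(_ _ (@closed_eq _ a)). Qed.

Lemma closed_forall (I : Type) (P : I -> set T) :
  (forall i, closed (P i)) -> closed [set x | forall i, P i x].
Proof.
move=> Pc; have -> : [set x | forall i, P i x] = \bigcap_i P i.
  by apply/seteqP; split=> x /= H i //; exact: H.
by apply: closed_bigI => i _; exact: Pc.
Qed.

End Closed.

Section UnitSphere.
Variables (R : realType) (X : space_form) (m : nat).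
Local Notation B := (@form R X m).

(** By compactness of the unit sphere of the norm, the form on [S] is at least a positive multiple
    of the squared norm, so its unit vectors are bounded. *)
Lemma compact_unit_sphere (S : set 'rV[R]_m) : closed S ->
  (forall y a, S y -> 0 <= a -> S (a *: y)) ->
  (forall y, S y -> y != 0 -> 0 < B y y) ->
  compact [set y | S y /\ B y y = 1].
Proof.
move=> Sc SZ Spos.
have nc : continuous (fun y : 'rV[R]_m => `|y|) by exact: norm_continuous.
pose K := [set y | S y /\ `|y| = 1].
have Kc : compact K.
  apply: bounded_closed_compact; last first.
    by apply: closedI => //; exact: closed_eq_fun.
  by exists 1; split => // N N1 y [_ y1]; rewrite /= y1 ltW.
apply: bounded_closed_compact; last first.
  by apply: closedI => //; apply: closed_eq_fun; exact: form_diag_continuous.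
have [K0|/set0P K0] := eqVneq K set0.
  exists 0; split => // N N0 y [Sy y1].
  have y0 : y != 0.
    by apply/eqP => y0; move: y1; rewrite y0 form0l => /eqP;
      rewrite eq_sym oner_eq0.
  have : K (`|y|^-1 *: y).
    split; first by apply: SZ.
    by rewrite normrZ normfV normr_id mulVf // normr_eq0.
  by rewrite K0.
have [c cK cmin] := @compact_EVT_min _ R (fun y => B y y) K K0 Kc
  (continuous_subspaceT (@form_diag_continuous R X m)).
move: cK; rewrite inE => -[Sc1 c1].
have c0 : 0 < B c c.
  by apply: Spos => //; rewrite -normr_gt0 c1.
exists (1 + (B c c)^-1); split => [|N N0 y [Sy y1]]; first exact: num_real.
apply: le_trans (ltW N0).
have y0 : y != 0.
  by apply/eqP => y0; move: y1; rewrite y0 form0l => /eqP;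
    rewrite eq_sym oner_eq0.
have ny : 0 < `|y| by rewrite normr_gt0.
have : K (`|y|^-1 *: y).
  split; first by apply: SZ.
  by rewrite normrZ normfV normr_id mulVf // normr_eq0.
rewrite -[K _]inE => /cmin; rewrite formZl formZr y1 mulr1 => H.
have {H} H : B c c * `|y| ^+ 2 <= 1.
  have := ler_wpM2r (exprn_ge0 2 (ltW ny)) H.
  by rewrite expr2 mulrACA mulVf ?gt_eqF // mulr1.
have H2 : `|y| ^+ 2 <= (B c c)^-1.
  by rewrite -[leRHS]mul1r ler_pdivlMr // mulrC.
nra.
Qed.

End UnitSphere.

(** * The tangent cone at a common point of walls *)

Section LocalCone.
Variables (R : realType) (X : space_form) (m : nat).
Local Notation B := (@form R X m).
Variables (I : finType) (v p : I -> 'rV[R]_m).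

(** The span of the normals replaces the quotient of the ambient space by their common kernel; the
    form is definite on it, even when it is Lorentzian. *)
Definition in_span (y : 'rV[R]_m) := exists c : I -> R, y = \sum_i c i *: v i.

Hypothesis posdef : forall y, in_span y -> y != 0 -> 0 < B y y.
Hypothesis norm1 : forall i, B (v i) (v i) = 1.
Hypothesis p_on : forall i, B (v i) (p i) = 0.
Hypothesis p_in : forall i j, j != i -> B (v j) (p i) < 0.
Hypothesis cardI : (2 < #|I|)%N.

Lemma in_span_lin a y z : in_span y -> in_span z -> in_span (a *: y + z).
Proof.
move=> [c ->] [d ->]; exists (fun i => a * c i + d i).
rewrite scaler_sumr -big_split; apply: eq_bigr => i _ /=.
by rewrite scalerA scalerDl.
Qed.

Lemma in_span0 : in_span 0.
Proof. by exists (fun=> 0); rewrite big1 // => i _; rewrite scale0r. Qed.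

Lemma in_spanZ a y : in_span y -> in_span (a *: y).
Proof. by move=> /(in_span_lin a)/(_ in_span0); rewrite addr0. Qed.

Lemma in_spanP y :
  in_span y <-> forall l, (forall i, B (v i) l = 0) -> B y l = 0.
Proof.
split=> [[c ->] l vl|H].
  by rewrite form_suml big1 // => i _; rewrite formZl vl mulr0.
have [|c yE] := @span_of_annihilator R X m I predT v y.
  by move=> w Hw; apply: H => i; exact: Hw.
by exists c.
Qed.

Lemma closed_in_span : closed in_span.
Proof.
have -> : in_span = [set y | forall l : {l | forall i, B (v i) l = 0},
    B (sval l) y = 0].
  apply/seteqP; split=> y /=; first by move=> /in_spanP H [l vl] /=;
    rewrite formC H.
  by move=> H; apply/in_spanP => l vl; rewrite formC; exact: (H (exist _ l vl)).
apply: closed_forall => l; apply: closed_eq_fun; exact: form_continuous.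
Qed.

Lemma span_pointed y : in_span y -> (forall i, B (v i) y = 0) -> y = 0.
Proof.
move=> /[dup] ys /in_spanP yv vy; apply/eqP/negPn/negP => /(posdef ys).
by rewrite yv ?ltxx.
Qed.

(** The normal equations for the coefficients are solved by [farkas_eq]: a vector [t] in the kernel
    of the Gram matrix gives a combination of normals orthogonal to all of them, which vanishes by
    definiteness. *)
Lemma orthogonal_projection w :
  exists2 u, in_span u & forall y, in_span y -> B y u = B y w.
Proof.
have [|||c cE] := @farkas_eq R {ffun I -> R^o} I predT
  (fun j t => \sum_i t i * B (v i) (v j)) (fun t => \sum_i t i * B (v i) w).
- move=> j a s t; rewrite mulr_sumr -big_split; apply: eq_bigr => i _ /=.
  by rewrite !ffunE /GRing.scale /=; ring.
- move=> a s t; rewrite mulr_sumr -big_split; apply: eq_bigr => i _ /=.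
  by rewrite !ffunE /GRing.scale /=; ring.
- move=> t H; have t0 : \sum_i t i *: v i = 0.
    apply: span_pointed; first by exists t.
    move=> j; rewrite formC form_suml -[RHS](H j isT).
    by apply: eq_bigr => i _; rewrite formZl.
  have : B (\sum_i t i *: v i) w = 0 by rewrite t0 form0l.
  rewrite form_suml => E; rewrite -[RHS]E; apply: eq_bigr => i _.
  by rewrite formZl.
exists (\sum_j c j *: v j); first by exists c.
move=> _ [d ->]; rewrite form_suml [RHS]form_suml; apply: eq_bigr => i _.
rewrite !formZl; congr (_ * _).
have := cE [ffun k => (k == i)%:R]; rewrite (bigD1 i) //= big1 => [|k ki];
  last first.
  by rewrite ffunE (negbTE ki) mul0r.
rewrite ffunE eqxx mul1r addr0 => ->; rewrite form_sumr; apply: eq_bigr => j _.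
rewrite formZr (bigD1 i) //= big1 => [|k ki];
  last by rewrite ffunE (negbTE ki) mul0r.
by rewrite ffunE eqxx mul1r addr0.
Qed.

Lemma v_in_span i : in_span (v i).
Proof.
exists (fun j : I => (j == i)%:R);
  rewrite (bigD1 i) //= eqxx scale1r big1 ?addr0 //.
by move=> j /negbTE ->; rewrite scale0r.
Qed.

Lemma exists_other (i : I) : exists j : I, j != i.
Proof.
have /card_gt0P[j] : (0 < #|predC1 i|)%N.
  by rewrite cardC1; case: #|I| cardI => [|[]].
by exists j.
Qed.

Definition cone : set 'rV[R]_m :=
  [set y | in_span y /\ forall i, B (v i) y <= 0].

Lemma cone_strict y : cone y -> y != 0 -> exists i, B (v i) y < 0.
Proof.
move=> [ys yv] y0; apply: contrapT => /forallNP H; case/eqP: y0.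
apply: span_pointed => // i; apply/le_anti; rewrite yv /= leNgt.
exact/negP/H.
Qed.

Lemma coneZ a y : cone y -> 0 <= a -> cone (a *: y).
Proof.
move=> [ys yv] a0; split; first exact: in_spanZ.
by move=> i; rewrite formZr mulr_ge0_le0.
Qed.

Lemma cone_line a y z : 0 <= a -> cone y -> cone z -> cone (y + a *: z).
Proof.
move=> a0 [ys yv] [zs zv]; rewrite addrC; split; first exact: in_span_lin.
by move=> i; rewrite formDr formZr -oppr_ge0 opprD addr_ge0 // oppr_ge0 ?yv
  ?mulr_ge0_le0.
Qed.

Lemma closed_cone : closed cone.
Proof.
apply: closedI; first exact: closed_in_span.
apply: closed_forall => i; apply: closed_le_fun; exact: form_continuous.
Qed.

(** Every wall is missed by some [p k], so the sum of the [p k] is strictly inside all walls;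
    projection to the span keeps the pairings. *)
Lemma cone_interior : exists2 u, cone u & forall i, B (v i) u < 0.
Proof.
have [u us uE] := orthogonal_projection (\sum_k p k).
suff uv i : B (v i) u < 0 by exists u => //; split=> // i; exact: ltW.
rewrite (uE _ (v_in_span i)) form_sumr.
have [j ji] := exists_other i; rewrite (bigD1 j) //=.
have : B (v i) (p j) < 0 by rewrite p_in // eq_sym.
have : \sum_(k | k != j) B (v i) (p k) <= 0.
  apply: sumr_le0 => k _; have [->|ik] := eqVneq k i; first by rewrite p_on.
  by rewrite ltW // p_in // eq_sym.
lra.
Qed.

(** Pairing with [p i], [p j] and [p k] shows that any two coefficients both vanish or have opposite
    signs; three numbers can do so only if all vanish. *)
Lemma independent3 i j k a b c : i != j -> j != k -> k != i ->
  a *: v i + b *: v j + c *: v k = 0 -> [/\ a = 0, b = 0 & c = 0].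
Proof.
move=> ij jk ki E.
have H q : a * B (v i) q + b * B (v j) q + c * B (v k) q = 0.
  by rewrite -!formZl -!formDl E form0l.
have := H (p i); have := H (p j); have := H (p k); rewrite !p_on.
have := p_in ij; have := p_in jk; have := p_in ki.
move: ij jk ki; rewrite eq_sym => ij; rewrite eq_sym => jk;
  rewrite eq_sym => ki.
have := p_in ij; have := p_in jk; have := p_in ki.
case: (ltgtP a 0) => a0; case: (ltgtP b 0) => b0; case: (ltgtP c 0) => c0 *;
  split; nra.
Qed.

(** Two linear conditions on the span of three independent normals leave a nonzero solution. *)
Lemma exists_orthogonal t t' :
  exists z, [/\ in_span z, z != 0, B z t = 0 & B z t' = 0].
Proof.
have /card_gt2P[i [j [k [_ [ij jk ki]]]]] := cardI.
pose f (o : 'I_3) := tnth [tuple i; j; k] o.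
pose M := \matrix_(o < 3, e < 2) B (v (f o)) (if e == 0 then t else t').
have : kermx M != 0.
  by rewrite kermx_eq0 /row_free neq_ltn (leq_ltn_trans (rank_leq_col M)).
case/rowV0Pn => c /sub_kermxP cM c0.
pose z := \sum_o c 0 o *: v (f o).
have zM e : B z (if e == 0 :> 'I_2 then t else t') = 0.
  have /matrixP/(_ 0 e) := cM; rewrite !mxE => <-.
  by rewrite form_suml; apply: eq_bigr => o _; rewrite formZl mxE.
exists z; split; [|  |exact: (zM 0)|exact: (zM 1)].
- rewrite /z; elim/big_ind: _ => //; first exact: in_span0.
    by move=> x y xs ys; rewrite -[x]scale1r; exact: in_span_lin.
  by move=> o _; apply: in_spanZ; exact: v_in_span.
- apply: contraNneq c0; rewrite /z !big_ord_recr big_ord0 /= add0r.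
  rewrite /f !(tnth_nth i) /= => /(independent3 ij jk ki)[c1 c2 c3].
  apply/eqP/rowP => o; rewrite mxE; case: o => [[|[|[|//]]] o3].
  + by rewrite -[RHS]c1; congr (c _ _); exact/val_inj.
  + by rewrite -[RHS]c2; congr (c _ _); exact/val_inj.
  + by rewrite -[RHS]c3; congr (c _ _); exact/val_inj.
Qed.

(** For a nonzero vector of the cone this is extremality of its ray: the walls active at [w] cut the
    span down to a line. *)
Definition extremal w := forall x, in_span x ->
  (forall i, B (v i) w = 0 -> B (v i) x = 0) -> exists a, x = a *: w.

Definition active w := [pred i | B (v i) w == 0].

(** From a non-extremal [w], move inside the walls active at [w] until another wall is hit, keeping
    the pairing with [z] fixed. *)
Lemma more_active z w x : cone w -> B z w != 0 -> in_span x ->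
    (forall i, B (v i) w = 0 -> B (v i) x = 0) -> ~ (exists a, x = a *: w) ->
  exists w', [/\ cone w', B z w' != 0 & (#|active w| < #|active w'|)%N].
Proof.
move=> wc zw xs xv /forallNP xw.
pose x1 := x - (B z x / B z w) *: w.
have x1s : in_span x1.
  by rewrite /x1 addrC -scaleNr; apply: in_span_lin => //; case: wc.
have x1z : B z x1 = 0 by rewrite formBr formZr divfK // subrr.
have x1v i : B (v i) w = 0 -> B (v i) x1 = 0.
  by move=> vw; rewrite formBr formZr vw (xv _ vw) mulr0 subrr.
(* Up to sign the direction leaves the cone, because the cone is pointed. *)
have [x2 [x2s x2z x2v [i0 i0x]]] : exists x2, [/\ in_span x2, B z x2 = 0,
    forall i, B (v i) w = 0 -> B (v i) x2 = 0 & exists i, 0 < B (v i) x2].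
  have [H|/forallNP H] := pselect (exists i, 0 < B (v i) x1).
    by exists x1.
  have [[i i1]|/forallNP H'] := pselect (exists i, B (v i) x1 < 0).
    exists (- x1); split.
    - by rewrite -scaleN1r; exact: in_spanZ.
    - by rewrite formNr x1z oppr0.
    - by move=> j /x1v; rewrite formNr => ->; rewrite oppr0.
    - by exists i; rewrite formNr oppr_gt0.
  case: (xw (B z x / B z w)); apply/eqP; rewrite -subr_eq0; apply/eqP.
  apply: span_pointed => // i; apply/le_anti; rewrite !leNgt.
  by apply/andP; split; apply/negP.
case: (@arg_minP _ R I i0 (fun i => 0 < B (v i) x2)
  (fun i => - B (v i) w / B (v i) x2) i0x) => s sx smin.
(* [s] is the first wall that is met, at time [e]. *)
pose e := - B (v s) w / B (v s) x2.
have e0 : 0 <= e.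
  by apply: divr_ge0; [rewrite oppr_ge0; case: wc|exact: ltW].
have vw' i : B (v i) (e *: x2 + w) = e * B (v i) x2 + B (v i) w.
  by rewrite formDr formZr.
exists (e *: x2 + w); split.
- split=> [|i]; first by apply: in_span_lin => //; case: wc.
  have wi : B (v i) w <= 0 by case: wc.
  rewrite vw'; have [ix|ix] := leP (B (v i) x2) 0.
    have : e * B (v i) x2 <= 0 by rewrite mulr_ge0_le0.
    lra.
  by have := smin _ ix; rewrite -/e ler_pdivlMr //; lra.
- by rewrite formDr formZr x2z mulr0 add0r.
- apply/proper_card/properP; split.
    apply/fintype.subsetP => i; rewrite !inE => /eqP wi.
    by rewrite vw' wi x2v // mulr0 addr0.
  exists s; rewrite !inE.
    by rewrite vw' divfK ?(gt_eqF sx) // addNr.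
  by apply/eqP => /x2v sx0; move: sx; rewrite sx0 ltxx.
Qed.

(** [more_active] is iterated from an interior vector, shifted along [z] if it is orthogonal to
    [z]. *)
Lemma extremal_ray z : in_span z -> z != 0 ->
  exists w, [/\ cone w, B z w != 0 & extremal w].
Proof.
move=> zs z0.
have [w0 w0c zw0] : exists2 w0, cone w0 & B z w0 != 0.
  have [u uc uv] := cone_interior.
  have [zu|zu] := eqVneq (B z u) 0; last by exists u.
  have [||e e0 He] := @small_step R I (fun i => - B (v i) u)
    (fun i => B (v i) z).
  - by move=> i; rewrite oppr_ge0 ltW.
  - by move=> i /eqP; rewrite oppr_eq0 lt_eqF.
  exists (e *: z + u); last first.
    by rewrite formDr formZr zu addr0 mulf_neq0 // gt_eqF // posdef.
  split; first by apply: in_span_lin => //; case: uc.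
  move=> i; have := He e i; rewrite lexx ltW // => /(_ isT).
  by rewrite formDr formZr; lra.
have [N HN] := ubnP (#|I| - #|active w0|)%N.
elim: N => // N IH in w0 w0c zw0 HN *.
have [ext|/existsNP[x /not_implyP[xs /not_implyP[xv xw]]]] :=
  pselect (extremal w0); first by exists w0.
have [w [wc zw act]] := more_active w0c zw0 xs xv xw.
apply: (IH w) => //; have := max_card (active w).
by move: HN act; move: #|active w0| #|active w| #|I| => a b c; lia.
Qed.

(** The induction hypothesis on the number of walls: a short move along [d] leaves at least one of
    them. *)
Hypothesis loc : forall d i j, (forall k, B (v k) d <= 0) ->
  (exists k, B (v k) d < 0) -> i != j -> B (v i) d = 0 -> B (v j) d = 0 ->
  B (v i) (v j) <= 0.

(* The positive and negative parts of the coefficients of -y are separated by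
   pairing the positive combination with y. *)
Lemma nonobtuse_dual (A : pred I) (c : I -> R) y :
  y = \sum_(i | A i) c i *: v i -> (forall i, A i -> B (v i) y <= 0) ->
  (forall i j, A i -> A j -> i != j -> B (v i) (v j) <= 0) ->
  exists2 d : I -> R, (forall i, 0 <= d i) & y = - \sum_(i | A i) d i *: v i.
Proof.
move=> yE vy obt.
pose q i := Num.max (c i) 0; pose n i := Num.max (- c i) 0.
have q0 i : 0 <= q i by rewrite le_max lexx orbT.
have n0 i : 0 <= n i by rewrite le_max lexx orbT.
have qn i : c i = q i - n i.
  by rewrite /q /n; case: (leP (c i) 0) => ?; case: (leP (- c i) 0) => ?; lra.
have qn0 i : q i * n i = 0.
  rewrite /q /n; case: (leP (c i) 0) => ?; case: (leP (- c i) 0) => ?; nra.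
pose z := \sum_(i | A i) q i *: v i.
have {}yE : y = z - \sum_(i | A i) n i *: v i.
  rewrite yE -sumrB; apply: eq_bigr => i _; by rewrite qn scalerBl.
suff z0 : z = 0 by exists n => //; rewrite yE z0 sub0r.
apply/eqP/negPn/negP => z_neq0.
have : 0 < B z z.
  apply: posdef => //; exists (fun i => if A i then q i else 0).
  rewrite /z big_mkcond; apply: eq_bigr => i _.
  by case: ifP => //; rewrite scale0r.
have zy : B z y <= 0.
  rewrite form_suml; apply: sumr_le0 => i Ai.
  by rewrite formZl mulr_ge0_le0 // vy.
have : B z (\sum_(i | A i) n i *: v i) <= 0.
  rewrite form_suml; apply: sumr_le0 => i Ai; rewrite form_sumr.
  apply: sumr_le0 => j Aj; rewrite formZl formZr mulrA.
  have [<-|ij] := eqVneq i j; first by rewrite qn0 mul0r.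
  by rewrite mulr_ge0_le0 ?obt // mulr_ge0.
by move: zy; rewrite yE formBr; lra.
Qed.

(** Extremality puts the components of [y] and [y'] orthogonal to [w] in the span of the normals
    active at [w]. These are pairwise non-obtuse by [loc], so [nonobtuse_dual] writes one component
    as minus a nonnegative combination of them, and its pairing with the other is nonnegative. *)
Lemma acute_at_extremal w y y' : cone w -> w != 0 -> extremal w ->
  cone y -> cone y' -> B y w * B y' w <= B y y' * B w w.
Proof.
move=> wc w0 wext yc yc'.
have ww : 0 < B w w by apply: posdef => //; case: wc.
pose A := [pred i | B (v i) w == 0].
pose t x := x - (B x w / B w w) *: w.
have tw x : B (t x) w = 0 by rewrite formBl formZl divfK ?gt_eqF // subrr.
have ts x : cone x -> in_span (t x).
  by move=> [xs _]; rewrite /t addrC -scaleNr; apply: in_span_lin => //;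
    case: wc.
have tv x i : cone x -> A i -> B (v i) (t x) <= 0.
  by move=> [_ xv] /eqP wi; rewrite formBr formZr wi mulr0 subr0.
have tA x : cone x -> exists c : I -> R, t x = \sum_(i | A i) c i *: v i.
  move=> xc; apply: (@span_of_annihilator _ X) => l lA.
  have [u us uE] := orthogonal_projection l.
  have [i /eqP wi|a ua] := wext _ us.
    by rewrite (uE _ (v_in_span i)) lA.
  by rewrite -(uE _ (ts _ xc)) ua formZr tw mulr0.
have [c cE] := tA _ yc.
have [|i j /eqP wi /eqP wj ij|d d0 dE] := nonobtuse_dual cE.
- by move=> i; exact: tv.
- by apply: (loc (d := w)) => //; [case: wc|exact: cone_strict].
have : 0 <= B (t y) (t y').
  rewrite dE formNl oppr_ge0 form_suml; apply: sumr_le0 => i Ai.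
  by rewrite formZl mulr_ge0_le0 // tv.
rewrite {2}/t formBr formZr tw mulr0 subr0 /t formBl formZl [B w y']formC.
move=> /(ler_wpM2r (ltW ww)).
by rewrite mul0r mulrBl mulrAC divfK ?(gt_eqF ww) // subr_ge0.
Qed.

Lemma compact_unit_cone : compact [set y | cone y /\ B y y = 1].
Proof.
apply: compact_unit_sphere; first exact: closed_cone.
  by move=> y a yc a0; exact: coneZ.
by move=> y [ys _]; exact: posdef.
Qed.

Lemma normalize_cone y : cone y -> y != 0 ->
  exists2 a, 0 < a & cone (a *: y) /\ B (a *: y) (a *: y) = 1.
Proof.
move=> yc y0; have yy : 0 < B y y by apply: posdef => //; case: yc.
have s0 : 0 < Num.sqrt (B y y) by rewrite sqrtr_gt0.
exists (Num.sqrt (B y y))^-1; first by rewrite invr_gt0.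
split; first by apply: coneZ => //; rewrite invr_ge0 ltW.
by rewrite formZl formZr mulrA -expr2 exprVn sqr_sqrtr ?mulVf ?gt_eqF // ltW.
Qed.

(* If two unit vectors t, t' at maximal angle made an obtuse angle,
   acute_at_extremal would fail at an extremal ray w off both t and t'. *)
Lemma cone_acute y y' : cone y -> cone y' -> 0 <= B y y'.
Proof.
move=> yc yc'.
have [->|y0] := eqVneq y 0; first by rewrite form0l.
have [->|y'0] := eqVneq y' 0; first by rewrite form0r.
have [a a0 K1] := normalize_cone yc y0.
have [b b0 K2] := normalize_cone yc' y'0.
pose K := [set y | cone y /\ B y y = 1].
have Kc : compact (K `*` K) by apply: compact_setX; exact: compact_unit_cone.
have [|||[t t'] tK tmin] := @compact_EVT_min _ R
    (fun z : 'rV[R]_m * 'rV[R]_m => B z.1 z.2) (K `*` K).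
- by exists (a *: y, b *: y').
- exact: Kc.
- apply: continuous_subspaceT; apply: form_continuous2 => z.
    exact: cvg_fst.
  exact: cvg_snd.
move: tK; rewrite inE /= => -[[tc t1] [tc' t1']].
have tmin' z z' : K z -> K z' -> B t t' <= B z z'.
  by move=> Kz Kz'; apply: (tmin (z, z')); rewrite inE.
have : B t t' <= B (a *: y) (b *: y') by exact: tmin'.
rewrite formZl formZr mulrA => tab.
rewrite -(pmulr_rge0 _ (mulr_gt0 a0 b0)); apply: le_trans tab.
rewrite leNgt; apply/negP => tt0; pose c := - B t t'.
have c0 : 0 < c by rewrite oppr_gt0.
(* First variation of the cosine at a minimal pair, when [x] moves towards [w] on the unit
   sphere. *)
have order1 (x x' w : 'rV[R]_m) : K x -> K x' -> B x x' = - c -> cone w ->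
    0 <= B x' w + c * B x w.
  move=> [xc x1] [xc' x1'] xx wc.
  apply: (@first_order _ _ (c * B w w / 2) 1) => // e /andP[e0 _].
  have xwc : cone (x + e *: w) by apply: cone_line => //; exact: ltW.
  have xw0 : x + e *: w != 0.
    apply/eqP => xw0.
    have x0 : x != 0 by apply/eqP => x0; move: x1; rewrite x0 form0l; lra.
    have [i vix] := cone_strict xc x0.
    have ew : e * B (v i) w <= 0 by apply: mulr_ge0_le0; [exact: ltW|case: wc].
    by have := congr1 (B (v i)) xw0; rewrite formDr formZr form0r; lra.
  have [s s0 [sc s1]] := normalize_cone xwc xw0.
  have := tmin' _ _ (conj sc s1) (conj xc' x1').
  rewrite formZl formDl formZl xx -[B t t']opprK -/c.
  move: s1; rewrite formZl formZr formDl !formDr !formZl !formZr x1 [B w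
    x]formC.
  rewrite [B w x']formC => s1 H.
  have q0 : 0 < s^-1 by rewrite invr_gt0.
  have H' : - c * s^-1 <= - c + e * B x' w.
    have := ler_wpM2l (ltW q0) H; rewrite mulrA mulVf ?(gt_eqF s0) // mul1r.
    by rewrite mulrC.
  have qn : s^-1 ^+ 2 = 1 + 2 * e * B x w + e ^+ 2 * B w w.
    have -> : s^-1 ^+ 2 = s^-1 ^+ 2 * (s * (s * (1 + e * B x w + (e * B x w + e
      * (e * B w w))))).
      by rewrite s1 mulr1.
    by field; rewrite gt_eqF.
  (* As [s^-1] is the length of [x + e *: w], this bounds the length by half of one plus its
     square. *)
  have := sqr_ge0 (s^-1 - 1); nra.
have Kt : K t by [].
have Kt' : K t' by [].
have [z [zs z0 zt zt']] := exists_orthogonal t t'.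
have [w [wc zw wext]] := extremal_ray zs z0.
have w0 : w != 0 by apply: contraNneq zw => ->; rewrite form0r.
have H1 := acute_at_extremal wc w0 wext tc tc'.
have H2 := order1 _ _ w Kt Kt' (esym (opprK _)) wc.
have H3 : 0 <= B t w + c * B t' w.
  by apply: order1 => //; rewrite formC /c opprK.
(* Strict Cauchy-Schwarz: [x] and [w] are independent because [z] is orthogonal to [x] but not to
   [w]. *)
have CS x : K x -> B z x = 0 -> B x w ^+ 2 < B w w.
  move=> [[xs _] x1] zx; have : 0 < B (w - B x w *: x) (w - B x w *: x).
    apply: posdef.
      by rewrite addrC -scaleNr; apply: in_span_lin => //; case: wc.
    apply: contraNneq zw => /(congr1 (B z)).
    by rewrite formBr formZr zx mulr0 subr0 form0r => ->.
  rewrite formBl !formBr !formZl !formZr x1 [B w x]formC; lra.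
have := CS _ Kt zt; have := CS _ Kt' zt'.
have ww : 0 < B w w by apply: posdef => //; case: wc.
move: H1 H2 H3; rewrite -[B t t']opprK -/c.
move: (B t w) (B t' w) (B w w) ww c0 => p' q r r0 c0 H1 H2 H3 Q P.
(* By [H1] the two pairings have opposite signs and product at most [- c * r]; [H2] or [H3] bounds
   the negative one in absolute value by [c] times the positive one, whose square is less than
   [r]. *)
have [p0|p0] := ltP 0 p'; have [q0|q0] := ltP 0 q; nra.
Qed.

(** Let [d] maximize [B (v j)] among the unit vectors of the cone on wall [i]. The multiplier
    condition writes [v j + c *: d], with [c > 0], as a nonnegative combination of active normals in
    which [v i] has positive weight. Pairing with [p j] makes the left side nonnegative by
    [cone_acute] and the right side negative. *)
Lemma local_nonobtuse i j : i != j -> B (v i) (v j) <= 0.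
Proof.
move=> ij; rewrite leNgt; apply/negP => vij.
have [u us uE] := orthogonal_projection (p i).
have uv k : B (v k) u = B (v k) (p i) by rewrite uE //; exact: v_in_span.
have uc : cone u.
  split=> // k; rewrite uv; have [->|ki] := eqVneq k i; first by rewrite p_on.
  by rewrite ltW // p_in.
have u0 : u != 0.
  apply/eqP => u0; have := uv j; rewrite u0 form0r.
  by have := p_in (i := i) (j := j); rewrite eq_sym ij => /(_ isT); lra.
have [a a0 aK] := normalize_cone uc u0.
pose K := [set y | (cone y /\ B y y = 1) /\ B (v i) y = 0].
have Kc : compact K.
  apply: (subclosed_compact _ compact_unit_cone); last by move=> y [].
  apply: closedI; last by apply: closed_eq_fun; exact: form_continuous.
  apply: compact_closed; first exact: norm_hausdorff.
  exact: compact_unit_cone.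
have [||d dK dmax] := @compact_EVT_max _ R (B (v j)) K _ Kc.
- by exists (a *: u); split => //; rewrite formZr uv p_on mulr0.
- by apply: continuous_subspaceT; exact: form_continuous.
move: dK; rewrite inE => -[[dc d1] di].
have d0 : d != 0 by apply/eqP => d0; move: d1; rewrite d0 form0l; lra.
pose c := - B (v j) d.
have dloc k : k != i -> B (v k) d = 0 -> B (v i) (v k) <= 0.
  move=> ki dk; apply: (loc (d := d)) => //; last by rewrite eq_sym.
    by case: dc.
  exact: cone_strict.
have c0 : 0 < c.
  rewrite oppr_gt0 lt_neqAle; case: (dc) => _ -> ; rewrite andbT.
  by apply/eqP => /dloc; rewrite eq_sym ij leNgt vij => /(_ isT).
have [|||||e [e0 ei] eE] := @release_wall R X m I (fun k => B (v k) d == 0) v i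
  (v j + c *: d).
- exact/eqP.
- exact: norm1.
- by move=> k /eqP dk ki; exact: dloc.
- by rewrite formDr formZr di mulr0 addr0.
- move=> w wi wA; have [w' ws wE] := orthogonal_projection w.
  have wv k : B (v k) w' = B (v k) w by rewrite wE //; exact: v_in_span.
  have ds : in_span d by case: dc.
  rewrite formDl formZl -wv -(wE _ ds).
  have [||e1 e10 He] := @small_step R I (fun k => - B (v k) d)
    (fun k => B (v k) w').
  + by move=> k; rewrite oppr_ge0; case: dc.
  + by move=> k /eqP; rewrite oppr_eq0 wv; exact: wA.
  (* The second-order term comes from comparing the squares of both sides of [H'] below; the second
     bound on the step keeps [d + s *: w'] nonzero, by pairing with [d]. *)
  rewrite -oppr_ge0; apply: (@first_order _ _ ((B (v j) w' ^+ 2 - c ^+ 2 * B w'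
    w') / (2 * c)) 
      (Num.min e1 (1 + `|B d w'|)^-1)).
    by rewrite lt_min e10 invr_gt0 ltr_wpDr.
  move=> s; rewrite le_min => /and3P[s0 se1 se2].
  have dwc : cone (d + s *: w').
    split; first by rewrite addrC; exact: in_span_lin.
    move=> k; have := He s k; rewrite se1 ltW // => /(_ isT).
    by rewrite formDr formZr; lra.
  have [dw0|dw0] := eqVneq (d + s *: w') 0.
    have := congr1 (B d) dw0; rewrite formDr formZr form0r d1.
    have : s * (1 + `|B d w'|) <= 1 by rewrite -ler_pdivlMr ?mul1r ?ltr_wpDr.
    by have := ler_norm (- B d w'); rewrite normrN; nra.
  have [r r0 rK] := normalize_cone dwc dw0.
  have : B (v j) (r *: (d + s *: w')) <= B (v j) d.
    apply: dmax; rewrite inE; split=> //.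
    by rewrite formZr formDr formZr wv wi di mulr0 addr0 mulr0.
  case: rK => _; rewrite !formZr formZl formDl !formDr !formZl !formZr d1 [B w'
    d]formC.
  rewrite -[B (v j) d]opprK -/c => r1 H.
  have q0 : 0 < r^-1 by rewrite invr_gt0.
  have H' : c * r^-1 <= c - s * B (v j) w'.
    have := ler_wpM2l (ltW q0) H; rewrite mulrA mulVf ?(gt_eqF r0) // mul1r.
    by lra.
  have qn : r^-1 ^+ 2 = 1 + 2 * s * B d w' + s ^+ 2 * B w' w'.
    have -> : r^-1 ^+ 2 = r^-1 ^+ 2 * (r * (r * (1 + s * B d w' + (s * B d w' +
      s * (s * B w' w'))))).
      by rewrite r1 mulr1.
    by field; rewrite gt_eqF.
  have H2 : (c * r^-1) ^+ 2 <= (c - s * B (v j) w') ^+ 2.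
    by rewrite ler_sqr ?nnegrE //; [nra|nra].
  have -> : s * - (B (v j) w' + c * B d w') +
      s ^+ 2 * ((B (v j) w' ^+ 2 - c ^+ 2 * B w' w') / (2 * c)) =
      ((c - s * B (v j) w') ^+ 2 - (c * r^-1) ^+ 2) / (2 * c).
    by rewrite [(c * r^-1) ^+ 2]exprMn qn; field; rewrite gt_eqF.
  by rewrite divr_ge0 ?subr_ge0 // mulr_ge0 ?ltW.
have [u' us' uE'] := orthogonal_projection (p j).
have dp : 0 <= B d (p j).
  have ds : in_span d by case: dc.
  rewrite -(uE' _ ds); apply: cone_acute => //; split=> // k.
  rewrite uE' ?p_on; last exact: v_in_span.
  by have [->|kj] := eqVneq k j; [rewrite p_on|rewrite ltW // p_in].
have := congr1 (fun x => B x (p j)) eE.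
rewrite formDl formZl p_on add0r form_suml (bigD1 i) ?di //= formZl.
have : e i * B (v i) (p j) < 0 by rewrite pmulr_rlt0 // p_in.
have : \sum_(k | (B (v k) d == 0) && (k != i)) B (e k *: v k) (p j) <= 0.
  apply: sumr_le0 => k _; rewrite formZl mulr_ge0_le0 //.
  by have [->|kj] := eqVneq k j; [rewrite p_on|rewrite ltW // p_in].
have : 0 <= c * B d (p j) by rewrite mulr_ge0 // ltW.
lra.
Qed.

End LocalCone.

(** * Points of the three space forms *)

Section Signature.
Variable R : realType.

Lemma form_definite X m (u : 'rV[R]_m) : X <> Hyperbolic -> u != 0 ->
  0 < form X u u.
Proof.
move=> XH u0; have sgn i : form_sign R X i = 1 by case: X XH.
have [i ui] : exists i, u 0 i != 0.
  by apply/existsP; apply: contraNT u0 => /existsPn H; apply/eqP/rowP => i;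
    rewrite mxE; apply/eqP/negPn/H.
rewrite /form (bigD1 i) //= sgn mul1r ltr_wpDr //.
  by apply: sumr_ge0 => j _; rewrite sgn mul1r -expr2 sqr_ge0.
by rewrite -expr2 exprn_even_gt0.
Qed.

(** * Causal vectors of Lorentzian space *)

Section Lorentz.
Variable n : nat.
Implicit Types x y u w : 'rV[R]_n.+1.
Local Notation B := (form Hyperbolic).

Lemma lorentzE u w :
  B u w = - (u 0 0 * w 0 0) + \sum_(i < n) u 0 (lift ord0 i) * w 0 (lift ord0
    i).
Proof.
rewrite /form big_ord_recl /= mulN1r; congr (_ + _).
by apply: eq_bigr => i _; rewrite mul1r.
Qed.

Lemma lorentz_space_ge0 w : w 0 0 = 0 -> 0 <= B w w.
Proof.
move=> w0; rewrite lorentzE w0 mulr0 oppr0 add0r.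
by apply: sumr_ge0 => i _; rewrite -expr2 sqr_ge0.
Qed.

Lemma lorentz_space_eq0 w : w 0 0 = 0 -> B w w = 0 -> w = 0.
Proof.
move=> w0; rewrite lorentzE w0 mulr0 oppr0 add0r => /eqP.
rewrite psumr_eq0 => [/allP H|i _]; last by rewrite -expr2 sqr_ge0.
apply/rowP => i; rewrite mxE; have [j ->|->//] := unliftP ord0 i.
by have := H j (mem_index_enum _); rewrite mulf_eq0 orbb => /eqP.
Qed.

(** The combination of [x] and [u] with vanishing time coordinate has nonnegative square, and this
    square has no cross term since [B x u = 0]. *)
Lemma timelike_orthogonal x u : B x x < 0 -> B x u = 0 -> u != 0 -> 0 < B u u.
Proof.
move=> xx xu u0.
pose w := x 0 0 *: u - u 0 0 *: x.
have w0 : w 0 0 = 0 by rewrite !mxE; ring.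
have ww : B w w = x 0 0 ^+ 2 * B u u + u 0 0 ^+ 2 * B x x.
  rewrite formBl !formBr !formZl !formZr [B u x]formC xu; ring.
have x0 : 0 < x 0 0 ^+ 2.
  rewrite exprn_even_gt0 //=; apply: contraTneq xx => x0.
  by rewrite -leNgt lorentz_space_ge0.
have := lorentz_space_ge0 w0; rewrite ww => H.
have H2 : 0 <= - (u 0 0 ^+ 2 * B x x) by rewrite -mulrN mulr_ge0 ?sqr_ge0 //
  oppr_ge0 ltW.
have uu : 0 <= B u u by nra.
rewrite lt_neqAle uu andbT; apply: contraNneq u0 => uu0.
apply/eqP/lorentz_space_eq0; last by [].
apply/eqP; rewrite -sqrf_eq0; apply/eqP; move: H H2; rewrite -uu0; nra.
Qed.

(** If [B x y] were nonnegative, the combination of [x] and [y] with vanishing time coordinate would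
    have negative square. The vector [y] may be ideal. *)
Lemma causal_form_lt0 x y : B x x < 0 -> 0 < x 0 0 -> B y y <= 0 -> 0 < y 0 0 ->
  B x y < 0.
Proof.
move=> xx x0 yy y0; rewrite ltNge; apply/negP => xy.
pose w := y 0 0 *: x - x 0 0 *: y.
have w0 : w 0 0 = 0 by rewrite !mxE; ring.
have := lorentz_space_ge0 w0.
rewrite formBl !formBr !formZl !formZr [B y x]formC.
have : y 0 0 * (y 0 0 * B x x) < 0 by rewrite !pmulr_rlt0.
have : x 0 0 * (x 0 0 * B y y) <= 0 by rewrite !pmulr_rle0.
have : 0 <= x 0 0 * (y 0 0 * B x y) by rewrite !mulr_ge0 // ltW.
lra.
Qed.

End Lorentz.
End Signature.

Section Points.
Variables (R : realType) (X : space_form) (n : nat).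
Local Notation V := 'rV[R]_(ambient_dim X n).
Local Notation B := (@form R X (ambient_dim X n)).
Implicit Types (x y z d : V) (h : V * R).

(* The vectors that a positive dilation, trivial in the Euclidean case, brings
   into the space form. *)
Definition admissible : V -> Prop :=
  match X return 'rV[R]_(ambient_dim X n) -> Prop with
  | Euclidean => fun=> True
  | Spherical => fun y : 'rV[R]_n.+1 => y != 0
  | Hyperbolic => fun y : 'rV[R]_n.+1 => form Hyperbolic y y < 0 /\ 0 < y 0 0
  end.

Definition slack h x := B h.1 x - h.2.

End Points.

Section PointsTheory.
Variables (R : realType) (n : nat).

Lemma euclideanP X : X = Euclidean \/ X <> Euclidean.
Proof. by case: X; [left|right|right]. Qed.

Lemma space_euclidean X (x : 'rV[R]_(ambient_dim X n)) :
  X = Euclidean -> space x.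
Proof. by case: X x. Qed.

Lemma normalize_space X (y : 'rV[R]_(ambient_dim X n)) : admissible y ->
  exists s, [/\ 0 < s, X = Euclidean -> s = 1 & space (s *: y)].
Proof.
case: X y => [y _|y y0|y [yy y0]].
- by exists 1; split.
- have yy : 0 < form Spherical y y by apply: form_definite.
  exists (Num.sqrt (form Spherical y y))^-1; split=> //.
    by rewrite invr_gt0 sqrtr_gt0.
  by rewrite /= formZl formZr mulrA -expr2 exprVn sqr_sqrtr ?mulVf ?gt_eqF //
    ltW.
- have yy' : 0 < - form Hyperbolic y y by rewrite oppr_gt0.
  have s0 : 0 < (Num.sqrt (- form Hyperbolic y y))^-1 by rewrite invr_gt0
    sqrtr_gt0.
  exists (Num.sqrt (- form Hyperbolic y y))^-1; split=> //=.
  split; last by rewrite mxE mulr_gt0.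
  rewrite formZl formZr mulrA -expr2 exprVn sqr_sqrtr; last exact: ltW.
  by rewrite -[X in _ * X]opprK mulrN mulVf // gt_eqF.
Qed.

Variable X : space_form.
Local Notation V := 'rV[R]_(ambient_dim X n).
Local Notation B := (@form R X (ambient_dim X n)).
Implicit Types (x y z d : V) (h : V * R).

Lemma slackZ h s y : halfspace_data h -> (X = Euclidean -> s = 1) ->
  slack h (s *: y) = s * slack h y.
Proof.
move=> [_ h2] s1; rewrite /slack formZr mulrBr; congr (_ - _).
have [/s1->|/h2->] := euclideanP X.
  by rewrite mul1r.
by rewrite mulr0.
Qed.

(** Convexity for the three models at once: [z] lies on the geodesic segment from [x] to [y]. Only
    antipodal points of the sphere can make the combination vanish. *)
Lemma combine x y a b : space x -> space y -> 0 < a -> 0 < b ->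
  (X = Spherical -> a *: x + b *: y != 0) ->
  exists z s, [/\ 0 < s, space z & forall h, halfspace_data h ->
    slack h z = s * (a * slack h x + b * slack h y)].
Proof.
move=> xX yX a0 b0 nz.
have [XE|XE] := euclideanP X.
  exists ((a + b)^-1 *: (a *: x + b *: y)), (a + b)^-1; split.
  - by rewrite invr_gt0 addr_gt0.
  - exact: space_euclidean.
  - move=> h _; rewrite /slack formZr formDr !formZr; field.
    by rewrite gt_eqF // addr_gt0.
have [s [s0 sE zX]] : exists s, [/\ 0 < s, X = Euclidean -> s = 1 &
    space (s *: (a *: x + b *: y))].
  apply: normalize_space.
  move: xX yX nz {XE}; clear -a0 b0; case: X x y => //= x y.
    by move=> _ _; apply.
  move=> [xx x0] [yy y0] _; split; last by rewrite !mxE addr_gt0 ?mulr_gt0.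
  rewrite formDl !formDr !formZl !formZr xx yy [form _ y x]formC.
  have xy : form Hyperbolic x y < 0.
    by apply: causal_form_lt0 => //; rewrite ?xx ?yy ?ltrN10 ?lerN10.
  have : a * (b * form Hyperbolic x y) < 0 by rewrite !pmulr_rlt0.
  nra.
exists (s *: (a *: x + b *: y)), s; split => // h hh.
by rewrite slackZ // /slack formDr !formZr (hh.2 XE) !subr0.
Qed.

Lemma admissible_near x d : space x ->
  exists2 e0, 0 < e0 & forall e, 0 <= e <= e0 -> admissible (x + e *: d).
Proof.
case: X x d => [x d _|x d x1|x d [xx x0]]; first by exists 1.
  exists (1 + `|form Spherical x d|)^-1; first by rewrite invr_gt0 ltr_wpDr.
  move=> e /andP[e0 e1] /=; apply/eqP => /(congr1 (form Spherical x)).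
  rewrite formDr formZr form0r x1.
  have : e * (1 + `|form Spherical x d|) <= 1 by rewrite -ler_pdivlMr ?mul1r
    ?ltr_wpDr.
  have [e00|/negP] := eqVneq e 0; first by rewrite e00 mul0r; lra.
  move=> en; have {}e0 : 0 < e by rewrite lt_neqAle e0 andbT eq_sym; exact/negP.
  by have := ler_norm (- form Spherical x d); rewrite normrN; nra.
(* For [e <= 1] the square of [x + e *: d] is at most [-1 + e * c1]. *)
pose c1 := 2 * form Hyperbolic x d + `|form Hyperbolic d d|.
have [||e0 e00 He] := @small_step R bool
    (fun b => if b then 1 / 2 else x 0 0 / 2)
      (fun b => if b then c1 else - d 0 0).
- by case; lra.
- by case; lra.
exists (Num.min e0 1); first by rewrite lt_min e00 ltr01.
move=> e; rewrite le_min => /and3P[e_ge0 ee0 e1] /=.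
have H1 := He e true; have H2 := He e false; move: H1 H2.
rewrite e_ge0 ee0 => /(_ isT) H1 /(_ isT) H2.
rewrite !mxE; split; last by lra.
rewrite formDl !formDr !formZl !formZr xx [form _ d x]formC.
have : e * (e * form Hyperbolic d d) <= e * `|form Hyperbolic d d|.
  apply: ler_wpM2l => //; apply: le_trans (ler_norm _) _.
  by rewrite normrM ger0_norm // ler_piMl.
move: H1; rewrite /c1; lra.
Qed.

Lemma posdef_at x u : space x -> (X = Hyperbolic -> B u x = 0) -> u != 0 ->
  0 < B u u.
Proof.
case: X x u => [x u _ _|x u _ _|x u [xx _] /(_ erefl) ux].
- exact: form_definite.
- exact: form_definite.
- by apply: (timelike_orthogonal (x := x)); rewrite ?xx ?ltrN10 // formC.
Qed.

(* Tangent direction at x towards y, taken modulo x in the linear models. *)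
Definition direction x y := if X is Euclidean then y - x else y.

Lemma direction_euclidean x y : X = Euclidean -> direction x y = y - x.
Proof. by rewrite /direction; case: X x y. Qed.

Lemma direction_linear x y : X <> Euclidean -> direction x y = y.
Proof. by rewrite /direction; case: X x y. Qed.

Lemma slack_direction h x y : halfspace_data h -> slack h x = 0 ->
  B h.1 (direction x y) = slack h y.
Proof.
rewrite /direction /slack; case: X h x y => h x y [_ hE] hx.
- by rewrite formBr; lra.
- by rewrite hE // subr0.
- by rewrite hE // subr0.
Qed.

End PointsTheory.

(** * Annihilators and closest points *)

Section Annihilator.
Variables (R : realType) (X : space_form) (m r : nat) (u : 'I_r -> 'rV[R]_m).
Local Notation B := (@form R X m).

(** The signs of the form are absorbed in the columns, so that the annihilator is a kernel and
    rank-nullity applies. *)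
Let M : 'M[R]_(m, r) := \matrix_(l, e) (form_sign R X l * u e 0 l).

Let f : 'Hom('rV[R]_m, 'rV[R]_r) := linfun (mulmxr M).

Definition annihilator : {vspace 'rV[R]_m} := lker f.

Let formM w e : (w *m M) 0 e = B (u e) w.
Proof. by rewrite !mxE; apply: eq_bigr => l _; rewrite mxE; ring. Qed.

Lemma annihilatorP w : reflect (forall e, B (u e) w = 0) (w \in annihilator).
Proof.
rewrite memv_ker lfunE /=; apply: (iffP eqP) => [wM e|H].
  by rewrite -formM wM mxE.
by apply/rowP => e; rewrite formM H mxE.
Qed.

Let rank_nullity :
  (\dim annihilator + \dim (f @: fullv)%VS = m)%N.
Proof.
have := limg_ker_dim f fullv.
rewrite (capv_idPr (subvf _)) => ->.
by rewrite dimvf /dim /= mul1n.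
Qed.

(** Surjectivity of the pairings expresses the linear independence of the [u e]. *)
Lemma dim_annihilator :
  (forall t : 'rV[R]_r, exists w, forall e, B (u e) w = t 0 e) ->
  \dim annihilator = (m - r)%N.
Proof.
move=> H; rewrite -[X in (X - r)%N]rank_nullity.
suff -> : (f @: fullv)%VS = fullv.
  by rewrite dimvf /dim /= mul1n addnK.
apply/eqP; rewrite eqEsubv subvf /=; apply/subvP => t _.
have [w wt] := H t; apply/memv_imgP; exists w; first exact: memvf.
by rewrite lfunE /=; apply/rowP => e; rewrite formM wt.
Qed.

Lemma annihilator_neq0 : (r < m)%N -> exists2 w, w != 0 & forall e,
  B (u e) w = 0.
Proof.
move=> rm; have : annihilator != 0%VS.
  rewrite -dimv_eq0 -lt0n.
  have := rank_nullity; have := dimvS (subvf (f @: fullv)%VS).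
  rewrite dimvf /dim /= mul1n.
  by move: (\dim annihilator) (\dim (_ @: _)%VS) => a b; lia.
rewrite -vpick0 => w0; exists (vpick annihilator) => //.
exact/annihilatorP/memv_pick.
Qed.

End Annihilator.

Section NearestPoint.
Variables (R : realType) (X : space_form) (m : nat).
Local Notation B := (@form R X m).

Lemma compact_box (K : set 'rV[R]_m) (b : 'I_m -> R * R) : closed K ->
  (forall x, K x -> forall i, (b i).1 <= x 0 i <= (b i).2) -> compact K.
Proof.
move=> Kc Kb; apply: (subclosed_compact Kc
  (rV_compact (fun i => @segment_compact _ (b i).1 (b i).2))).
by move=> x Kx i /=; rewrite in_itv /= Kb.
Qed.

Lemma coord_sqr_le_form (x : 'rV[R]_m) i :
  X <> Hyperbolic -> x 0 i ^+ 2 <= B x x.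
Proof.
move=> XH; have sgn l : form_sign R X l = 1 by case: X XH.
rewrite /form (bigD1 i) //= sgn mul1r -expr2 lerDl.
by apply: sumr_ge0 => j _; rewrite sgn mul1r -expr2 sqr_ge0.
Qed.

(** The distance to [y] is minimized over the compact set of feasible points no farther from [y]
    than [z]; [farkas_form] turns the first-order conditions into multipliers. *)
Lemma nearest_point (I : finType) (v : I -> 'rV[R]_m) (a : I -> R) z y :
  X <> Hyperbolic -> (forall i, B (v i) z <= a i) ->
  exists x (c : I -> R), [/\ forall i, B (v i) x <= a i, forall i, 0 <= c i &
    y - x = \sum_(i | B (v i) x == a i) c i *: v i].
Proof.
move=> XH zP; pose r := B (z - y) (z - y).
pose K := [set x | (forall i, B (v i) x <= a i) /\ B (x - y) (x - y) <= r].
have cont : continuous (fun x : 'rV[R]_m => B (x - y) (x - y)).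
  have cs : continuous (fun x : 'rV[R]_m => x - y).
    by move=> x; apply: (@continuousB _ _ _ id (fun=> y) x);
      [apply: cvg_id|apply: cst_continuous].
  exact: form_continuous2.
have Kc : compact K.
  apply: (@compact_box K (fun i => (y 0 i - (r + 1), y 0 i + (r + 1)))).
    apply: closedI; last exact: closed_le_fun.
    by apply: closed_forall => i; apply: closed_le_fun; exact: form_continuous.
  move=> x [_ xr] i /=; have := coord_sqr_le_form (x - y) i XH;
    rewrite !mxE => H.
  have := sqr_ge0 (x 0 i - y 0 i - 1); have := sqr_ge0 (x 0 i - y 0 i + 1).
  by move=> H1 H2; apply/andP; split; lra.
have [|x xK xmin] := @compact_EVT_min _ R _ K _ Kc (continuous_subspaceT cont).
  by exists z.
move: xK; rewrite inE => -[xP xr].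
have [|c c0 cE] := @farkas_form R X m I (fun i => B (v i) x == a i) v (y - x).
  move=> w wA; rewrite -oppr_ge0.
  have [||e0 e00 He] := @small_step R I (fun i => a i - B (v i) x)
    (fun i => B (v i) w).
  - by move=> i; rewrite subr_ge0.
  - by move=> i /subr0_eq/esym/eqP; exact: wA.
  apply: (@first_order _ _ (B w w / 2) e0) => // e /andP[e_gt0 ee0].
  have H : forall i, B (v i) (x + e *: w) <= a i.
    by move=> i; have := He e i; rewrite ee0 ltW // formDr formZr => /(_ isT);
      lra.
  have xwy : B (x - y) (x - y) <= B (x + e *: w - y) (x + e *: w - y).
    have [le_r|/ltW r_le] := leP (B (x + e *: w - y) (x + e *: w - y)) r.
      by apply: xmin; rewrite inE.
    exact: le_trans r_le.
  move: xwy; have -> : x + e *: w - y = (x - y) + e *: w by rewrite addrAC.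
  rewrite -[y - x]opprB formNl; move: (x - y) => t.
  rewrite formDl !formDr !formZl !formZr [B w t]formC.
  lra.
by exists x, c.
Qed.

End NearestPoint.

(** * Extremal points in hyperbolic space *)

Section HyperbolicExtremum.
Variables (R : realType) (n : nat).
Implicit Types x y w c p : 'rV[R]_n.+1.
Local Notation B := (@form R Hyperbolic n.+1).

(** The function [- B x x / B c x ^+ 2] is homogeneous of degree 0 and equals [B c x ^- 2] on
    hyperbolic space. It is maximized on the compact slice [x 0 0 = 1] of the closed causal cone;
    being zero at ideal points and positive at [p], it has no ideal maximum. For [c] a point or the
    unit normal of a hyperplane, this minimizes the distance to it. *)
Lemma hyperbolic_extremum (I : finType) (u : I -> 'rV[R]_n.+1) c p :
  B p p < 0 -> 0 < p 0 0 -> (forall i, B (u i) p <= 0) ->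
  (forall x, 0 < x 0 0 -> B x x <= 0 -> (forall i,
    B (u i) x <= 0) -> B c x < 0) ->
  exists x g, [/\ 0 < g, x 0 0 > 0 /\ B x x = -1, forall i, B (u i) x <= 0 &
    forall w, (forall i, B (u i) x = 0 -> B (u i) w <= 0) ->
      B (c - g *: x) w <= 0].
Proof.
move=> pp p0 pu cneg.
pose K := [set x : 'rV[R]_n.+1 | [/\ x 0 0 = 1, B x x <= 0 & forall i,
  B (u i) x <= 0]].
have c00 : continuous (fun x : 'rV[R]_n.+1 => x 0 0) by exact: coord_continuous.
have Kc : compact K.
  apply: (@compact_box R _ K (fun=> (-1, 1))).
    have -> : K = [set x : 'rV[R]_n.+1 | x 0 0 = 1] `&` ([set x | B x x <= 0]
      `&`
        [set x | forall i, B (u i) x <= 0]).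
      by apply/seteqP; split=> x /=; [case|case=> ? []].
    apply: closedI; first exact: closed_eq_fun.
    apply: closedI; first by apply: closed_le_fun; exact: form_diag_continuous.
    by apply: closed_forall => i; apply: closed_le_fun; exact: form_continuous.
  move=> x [x1 xx _] i /=; have [j ->|->] := unliftP ord0 i;
    last by rewrite x1; lra.
  move: xx; rewrite lorentzE x1 (bigD1 j) //=.
  have : 0 <= \sum_(l < n | l != j) x 0 (lift ord0 l) * x 0 (lift ord0 l).
    by apply: sumr_ge0 => l _; rewrite -expr2 sqr_ge0.
  nra.
pose f x := - B x x / B c x ^+ 2.
have fc : {in K, continuous f}.
  move=> x; rewrite inE => -[x1 xx xu].
  have cx : B c x < 0 by apply: cneg => //; rewrite x1.
  have n_cvg : {for x, continuous (fun y : 'rV[R]_n.+1 => - B y y)}.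
    by apply: continuousN; exact: form_diag_continuous.
  have d_cvg : {for x, continuous (fun y : 'rV[R]_n.+1 => B c y ^+ 2)}.
    exact: (continuousM (@form_continuous R Hyperbolic n.+1 c x)
                        (@form_continuous R Hyperbolic n.+1 c x)).
  by apply: (continuousM n_cvg); apply: continuousV => //;
    rewrite sqrf_eq0 lt_eqF.
have scale y : 0 < y 0 0 -> B y y <= 0 -> (forall i, B (u i) y <= 0) ->
    K ((y 0 0)^-1 *: y) /\ f ((y 0 0)^-1 *: y) = f y.
  move=> y0 yy yu; have iy0 : 0 < (y 0 0)^-1 by rewrite invr_gt0.
  split.
    split; first by rewrite mxE mulVf // gt_eqF.
      by rewrite formZl formZr !pmulr_rle0.
    by move=> i; rewrite formZr pmulr_rle0.
  rewrite /f !formZl !formZr; field.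
  by rewrite (gt_eqF y0) (lt_eqF (cneg _ y0 yy yu)).
have [Kp fp] := scale p p0 (ltW pp) pu.
have [|x xK xmax] := @compact_EVT_max _ R f K _ Kc (continuous_in_subspaceT fc).
  by exists ((p 0 0)^-1 *: p).
have fxmax y : 0 < y 0 0 -> B y y <= 0 -> (forall i,
  B (u i) y <= 0) -> f y <= f x.
  by move=> y0 yy yu; have [Ky <-] := scale y y0 yy yu; apply: xmax;
    rewrite inE.
move: xK; rewrite inE => -[x1 xx xu].
have cx : B c x < 0 by apply: cneg => //; rewrite x1.
have fx : 0 < f x.
  apply: lt_le_trans (fxmax _ p0 (ltW pp) pu).
  by rewrite divr_gt0 ?oppr_gt0 // exprn_even_gt0 //= lt_eqF // cneg // ltW.
have {}xx : B x x < 0.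
  by move: fx; rewrite /f pmulr_lgt0 ?oppr_gt0 // invr_gt0 exprn_even_gt0 //=
    lt_eqF.
have [|s [s0 _ [sx1 sx0]]] := @normalize_space R n Hyperbolic x.
  by split=> //=; rewrite x1.
exists (s *: x), (- (s * B c x)); split.
- by rewrite oppr_gt0 pmulr_rlt0.
- by [].
- by move=> i; rewrite formZr pmulr_rle0.
move=> w wu; set g := - (s * B c x).
have g0 : 0 < g by rewrite oppr_gt0 pmulr_rlt0.
have [e0 e00 He0] := @admissible_near R n Hyperbolic (s *: x) w (conj sx1 sx0).
have [||e1 e10 He1] := @small_step R I (fun i => - B (u i) (s *: x))
  (fun i => B (u i) w).
- by move=> i; rewrite oppr_ge0 formZr pmulr_rle0.
- by move=> i /eqP; rewrite oppr_eq0 => /eqP; exact: wu.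
rewrite -oppr_ge0 -(pmulr_rge0 _ g0) formBl formZl.
(* Clearing denominators in [f y <= g ^- 2] gives this quadratic in [e]. *)
apply: (@first_order _ _ ((B c w ^+ 2 + g ^+ 2 * B w w) / 2) (Num.min e0 e1)).
  by rewrite lt_min e00.
move=> e; rewrite le_min => /and3P[e_gt0 ee0 ee1].
have [|yy y0] := He0 e; first by rewrite ltW.
pose y := s *: x + e *: w.
have yu i : B (u i) y <= 0.
  by have := He1 e i; rewrite ltW // ee1 => /(_ isT);
    rewrite /y formDr (formZr _ _ e); lra.
have := fxmax y y0 (ltW yy) yu.
have -> : f x = g ^- 2.
  have : B (s *: x) (s *: x) = -1 by [].
  rewrite formZl formZr /f /g => sxx.
  have -> : - B x x = s ^- 2.
    have -> : B x x = (s * (s * B x x)) / s ^+ 2 by field; rewrite gt_eqF.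
    by rewrite sxx mulN1r opprK.
  by field; rewrite (gt_eqF s0) (lt_eqF cx).
have cy : B c y < 0 by apply: cneg => //; exact: ltW.
rewrite /f ler_pdivrMr; last by rewrite exprn_even_gt0 //= lt_eqF.
rewrite mulrC ler_pdivlMr ?exprn_gt0 //.
rewrite /y formDl !formDr !(formZl _ _ e) !(formZr _ _ e) [B w (s *: x)]formC
  sx1.
have -> : B c (s *: x) = - g by rewrite formZr opprK.
lra.
Qed.

End HyperbolicExtremum.

(** * Non-obtuse pairs of walls *)

Section Chamber.
Variables (R : realType) (X : space_form) (n k : nat).
Local Notation V := 'rV[R]_(ambient_dim X n).
Local Notation B := (@form R X (ambient_dim X n)).
Variable h : 'I_k -> V * R.
Hypothesis h_data : forall i, halfspace_data (h i).
Implicit Types (x y z d : V).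

Definition chamber x := space x /\ forall i, slack (h i) x <= 0.

Lemma move_in_chamber x d : chamber x ->
  (forall i, slack (h i) x = 0 -> B (h i).1 d <= 0) ->
  exists z s e, [/\ 0 < s /\ 0 < e, chamber z, z = s *: (x + e *: d),
    X = Euclidean -> s = 1 & forall i,
      slack (h i) z = 0 <-> slack (h i) x = 0 /\ B (h i).1 d = 0].
Proof.
move=> [xX xP] dP.
have [e0 e00 He0] := admissible_near d xX.
have [||e1 e10 He1] := @small_step R 'I_k (fun i => - slack (h i) x)
  (fun i => B (h i).1 d).
- by move=> i; rewrite oppr_ge0.
- by move=> i /eqP; rewrite oppr_eq0 => /eqP; exact: dP.
(* Half of the allowed step, so that walls inactive at [x] remain strictly inactive. *)
pose e := Num.min e0 (e1 / 2).
have e_gt0 : 0 < e by rewrite lt_min e00 divr_gt0.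
have ee0 : e <= e0 by rewrite ge_min lexx.
have ee1 : 2 * e <= e1 by rewrite mulrC -ler_pdivlMr // ge_min lexx orbT.
have [|s [s0 sE zX]] := @normalize_space R n X (x + e *: d).
  by apply: He0; rewrite ee0 ltW.
have zE i : slack (h i) (s *: (x + e *: d)) = s * (slack (h i) x + e * B (h
  i).1 d).
  by rewrite slackZ // /slack formDr formZr; congr (_ * _); ring.
have H i : 2 * e * B (h i).1 d <= - slack (h i) x.
  by apply: He1; rewrite ee1 andbT mulr_ge0 // ltW.
exists (s *: (x + e *: d)), s, e; split => //.
  split=> // i; rewrite zE pmulr_rle0 //.
  by have := H i; have := xP i; lra.
move=> i; rewrite zE; split=> [/eqP|[-> ->]]; last by rewrite mulr0 addr0 mulr0.
rewrite mulf_eq0 (gt_eqF s0) /= => /eqP E.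
have xi0 : slack (h i) x = 0 by have := H i; have := xP i; lra.
split=> //; apply/eqP; move/eqP: E; rewrite xi0 add0r mulf_eq0.
by rewrite (gt_eqF e_gt0).
Qed.

(** Witnesses that no wall is redundant: [p i] lies in the relative interior of the facet [i]. *)
Variables (p : 'I_k -> V).
Hypothesis p_space : forall i, space (p i).
Hypothesis p_on : forall i, slack (h i) (p i) = 0.
Hypothesis p_in : forall i j, j != i -> slack (h j) (p i) < 0.

Lemma p_chamber i : chamber (p i).
Proof.
split=> // j; have [->|ji] := eqVneq j i; first by rewrite p_on.
exact/ltW/p_in.
Qed.

Hypothesis ridge_nonobtuse : forall x i j, chamber x -> i != j ->
  (forall l, slack (h l) x = 0 <-> l = i \/ l = j) -> B (h i).1 (h j).1 <= 0.

(** Strong induction on the number of walls active at [x]. With only [i] and [j] active, [x] is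
    interior to a ridge. Otherwise [local_nonobtuse] is applied to the active normals and the
    directions to the points [p]. *)
Lemma vertex_nonobtuse x i j : chamber x -> i != j ->
  slack (h i) x = 0 -> slack (h j) x = 0 -> B (h i).1 (h j).1 <= 0.
Proof.
move=> xP ij xi xj.
pose act x := [pred l : 'I_k | slack (h l) x == 0].
have [N] := ubnP #|act x|; elim: N => // N IH in x xP i j ij xi xj *.
rewrite ltnS => HN.
have [[l [li lj xl]]|/forallNP H] :=
  pselect (exists l, [/\ l != i, l != j & slack (h l) x = 0]);
    last first.
  apply: (ridge_nonobtuse xP ij) => l; split=> [xl|[]-> //].
  have [li|li] := eqVneq l i; first by left.
  have [lj|lj] := eqVneq l j; first by right.
  by case: (H l).
pose I : finType := {l : 'I_k | slack (h l) x == 0}.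
pose emb l (xl : slack (h l) x = 0) : I := exist _ l (introT eqP xl).
have xI (a : I) : slack (h (val a)) x = 0 by exact/eqP/(valP a).
have := @local_nonobtuse R X _ I (fun a => (h (val a)).1)
  (fun a => direction x (p (val a))) _ _ _ _ _ _ (emb i xi) (emb j xj).
apply=> //.
(* In the hyperbolic case the active normals are orthogonal to the timelike vector [x], and the form
   is definite on its orthogonal. *)
- move=> y ys; apply: (posdef_at (x := x)); first by case: xP.
  move=> XH; have XE : X <> Euclidean by rewrite XH.
  apply: ((in_spanP X _ _).1 ys) => a; have := xI a.
  by rewrite /slack ((h_data (val a)).2 XE) subr0.
- by move=> a; case: (h_data (val a)).
- by move=> a; rewrite slack_direction.
- by move=> a b ba; rewrite slack_direction // p_in.
- apply/card_gt2P; exists (emb i xi), (emb j xj), (emb l xl).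
  by split; split; rewrite // -val_eqE //= eq_sym.
(* A short move along [d] leaves the wall [c] and creates no new active wall. *)
- move=> d a b dP [c cd] ab da db.
  have [z [s [e [_ zP _ _ zact]]]] :=
    move_in_chamber xP (fun q xq => dP (emb q xq)).
  apply: (IH z zP); rewrite ?val_eqE //.
  + by apply/zact; split.
  + by apply/zact; split.
  + apply: leq_trans HN; apply/proper_card/properP; split.
      by apply/fintype.subsetP => q; rewrite !inE => /eqP/zact[-> _].
    exists (val c); rewrite !inE; first exact/eqP/xI.
    by apply/eqP => /zact[_ cd0]; move: cd; rewrite cd0 ltxx.
Qed.

Lemma euclidean_nonobtuse i j : X = Euclidean -> i != j ->
  B (h i).1 (h j).1 <= 0.
Proof.
move=> XE ij.
have le_slack l x : (B (h l).1 x <= (h l).2) = (slack (h l) x <= 0).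
  by rewrite subr_le0.
have eq_slack l x : B (h l).1 x = (h l).2 <-> slack (h l) x = 0.
  by rewrite /slack; split=> [->|/subr0_eq//]; rewrite subrr.
apply: (@lp_nonobtuse R X _ _ (fun l => (h l).1)
  (fun l => (h l).2) i j (p i) (p j)) => //.
- by case: (h_data i).
- by move=> l; rewrite le_slack; case: (p_chamber i).
- exact/eq_slack/p_on.
- by move=> l; rewrite le_slack; case: (p_chamber j).
- exact/eq_slack/p_on.
- move=> x xP /eq_slack xi l li /eq_slack xl.
  apply: (@vertex_nonobtuse x) => //; last by rewrite eq_sym.
  by split=> [|q]; [exact: space_euclidean|rewrite -le_slack].
Qed.

Lemma normalize_chamber y : X <> Euclidean -> admissible y ->
  (forall l, B (h l).1 y <= 0) ->
  exists2 s, 0 < s & chamber (s *: y) /\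
    forall l, slack (h l) (s *: y) = s * B (h l).1 y.
Proof.
move=> XE /normalize_space[s [s0 _ yX]] yP; exists s => //.
have E l : slack (h l) (s *: y) = s * B (h l).1 y.
  by rewrite /slack (h_data l).2 // subr0 formZr.
by split=> //; split=> // l; rewrite E pmulr_rle0.
Qed.

Lemma admissible_spherical y : X = Spherical -> y != 0 -> admissible y.
Proof. by case: X y. Qed.

Lemma spherical_nonobtuse i j : (2 <= n)%N -> X = Spherical -> i != j ->
  B (h i).1 (h j).1 <= 0.
Proof.
move=> n2 XS ij.
have XE : X <> Euclidean by rewrite XS.
have slackE l x : slack (h l) x = B (h l).1 x by rewrite /slack (h_data l).2 //
  subr0.
(* [local_nonobtuse] requires three walls. With only two, [n + 1 > 2] provides a common unit vector,
   and the vertex case applies. *)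
have [k3|k2] := ltnP 2 k; last first.
  pose u (e : 'I_2) := if e == 0 then (h i).1 else (h j).1.
  have [|w w0 wE] := @annihilator_neq0 R X (ambient_dim X n) 2 u.
    by rewrite XS.
  have ijE l : l = i \/ l = j.
    have [li|li] := eqVneq l i; first by left.
    have [lj|lj] := eqVneq l j; first by right.
    have : (2 < #|'I_k|)%N.
      apply/card_gt2P; exists i, j, l; split; split=> //; rewrite eq_sym //.
    by rewrite card_ord ltnNge k2.
  have wl l : B (h l).1 w = 0 by case: (ijE l) => ->;
    [exact: (wE 0)|exact: (wE 1)].
  have [|s s0 [sP sE]] := normalize_chamber XE (admissible_spherical XS w0).
    by move=> l; rewrite wl.
  by apply: (vertex_nonobtuse sP) => //; rewrite sE wl mulr0.
apply: (@local_nonobtuse R X _ _ (fun l => (h l).1) p) => //.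
- by move=> y _; apply: form_definite; rewrite XS.
- by move=> l; case: (h_data l).
- by move=> l; rewrite -slackE.
- by move=> l q ql; rewrite -slackE p_in.
- by rewrite card_ord.
- move=> d a b dP [c cd] ab da db.
  have d0 : d != 0 by apply: contraTneq cd => ->; rewrite form0r ltxx.
  have [s s0 [sP sE]] := normalize_chamber XE (admissible_spherical XS d0) dP.
  by apply: (vertex_nonobtuse sP) => //; rewrite sE ?da ?db mulr0.
Qed.

Lemma active_on_wall x y (c : R) (lam : 'I_k -> R) i :
  (forall i j, i != j -> B (h i).1 (h j).1 <= 0) ->
  chamber x -> 0 < c -> (X = Euclidean -> c = 1) -> (forall l, 0 <= lam l) ->
  y - c *: x = \sum_(l | slack (h l) x == 0) lam l *: (h l).1 ->
  slack (h i) y = 0 -> slack (h i) x = 0.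
Proof.
move=> obt [xX xP] c0 cE lam0 E yi; apply/le_anti; rewrite xP /= leNgt.
apply/negP => xi.
have := congr1 (B (h i).1) E; rewrite form_sumr formBr.
have -> : B (h i).1 y = (h i).2 by apply/eqP; rewrite -subr_eq0; exact/eqP.
have : slack (h i) (c *: x) < 0 by rewrite slackZ // pmulr_rlt0.
rewrite /slack.
have : \sum_(l | slack (h l) x == 0) B (h i).1 (lam l *: (h l).1) <= 0.
  apply: sumr_le0 => l xl; rewrite formZr mulr_ge0_le0 // obt //.
  by apply: contraTneq xl => <-; rewrite lt_eqF.
lra.
Qed.

End Chamber.

(** * Hyperbolic polyhedra and their ideal points *)

Section HyperbolicChamber.
Variables (R : realType) (n k : nat).
Local Notation V := 'rV[R]_(ambient_dim Hyperbolic n).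
Local Notation B := (@form R Hyperbolic (ambient_dim Hyperbolic n)).
Variables (h : 'I_k -> V * R) (p : 'I_k -> V).
Hypothesis h_data : forall i, halfspace_data (h i).
Hypothesis p_space : forall i, space (p i).
Hypothesis p_on : forall i, slack (h i) (p i) = 0.
Hypothesis p_in : forall i j, j != i -> slack (h j) (p i) < 0.
Hypothesis vertex : forall x i j, chamber h x -> i != j ->
  slack (h i) x = 0 -> slack (h j) x = 0 -> B (h i).1 (h j).1 <= 0.

Let slackE l x : slack (h l) x = B (h l).1 x.
Proof. by rewrite /slack (h_data l).2 // subr0. Qed.

(* At an ideal point q the links of the walls form a Euclidean polyhedron in a
   horosphere, obtained here by slicing with the affine hyperplane <q, x> = -1. *)
Lemma ideal_nonobtuse (q : 'rV[R]_n.+1) i j :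
  0 < q 0 0 -> form Hyperbolic q q = 0 ->
  (forall l, B (h l).1 q <= 0) -> i != j -> B (h i).1 q = 0 ->
    B (h j).1 q = 0 ->
  B (h i).1 (h j).1 <= 0.
Proof.
move=> q0 qq qP ij qi qj.
pose act l := B (h l).1 q == 0.
(* Walls missing [q] become copies of the constraint [B q x <= -1], which also has the index
   [None]. *)
pose v (o : option 'I_k) : V :=
  if o is Some l then if act l then (h l).1 else q else q.
pose a (o : option 'I_k) : R :=
  if o is Some l then if act l then 0 else -1 else -1.
have qp l : form Hyperbolic q (p l) < 0.
  have [pp p0] := p_space l.
  by rewrite formC; apply: causal_form_lt0; rewrite ?pp ?qq ?ltrN10.
have scaled l : exists2 r, 0 < r & forall o, B (v o) (r *: p l) <= a o.
  exists (- form Hyperbolic q (p l))^-1; first by rewrite invr_gt0 oppr_gt0.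
  have vq : (- form Hyperbolic q (p l))^-1 * form Hyperbolic q (p l) <= -1.
    by rewrite invrN mulNr mulVf ?lexx // lt_eqF.
  case=> [m|] //=; last by rewrite formZr.
  rewrite /v /a /=; case: ifP => _; rewrite formZr // pmulr_rle0.
    rewrite -slackE; have [->|ml] := eqVneq m l; first by rewrite p_on.
    exact/ltW/p_in.
  by rewrite invr_gt0 oppr_gt0.
have [r1 r10 H1] := scaled i; have [r2 r20 H2] := scaled j.
have ai : act i by exact/eqP.
have aj : act j by exact/eqP.
have := @lp_nonobtuse R Hyperbolic _ _ v a (Some i) (Some j) (r1 *: p i) (r2 *:
  p j).
rewrite /v /a /= ai aj; apply => //.
- by case: (h_data i).
- by rewrite formZr -slackE p_on mulr0.
- by rewrite formZr -slackE p_on mulr0.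
(* For the added constraint the pairing of normals is [B (h i).1 q], which vanishes. *)
move=> x xP xi [l|] /=; last by move=> _ _; rewrite qi.
case: ifP => al li xl; last by rewrite qi.
have xq : form Hyperbolic q x <= -1 by exact: (xP None).
(* The vector [q + e *: x] lies on the walls [i] and [l]. These conditions on [e] keep it within the
   other walls, make it timelike thanks to [B q x <= -1], and keep its time coordinate positive. *)
pose b (o : 'I_k + bool) : R := match o with
  | inl m => - B (h m).1 q | inr true => 1 | inr false => q 0 0 / 2 end.
pose c (o : 'I_k + bool) : R := match o with
  | inl m => B (h m).1 x | inr true => `|form Hyperbolic x x|
  | inr false => - x 0 0 end.
have [||e e0 He] := @small_step R _ b c.
- by move=> [m|[]] /=; [rewrite oppr_ge0|lra|lra].
- move=> [m|[]] /=; [|lra|lra] => /eqP; rewrite oppr_eq0 => am.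
  by have := xP (Some m); rewrite /v /a /act /= am.
have {}He o : e * c o <= b o by apply: He; rewrite lexx ltW.
pose y : V := q + e *: x.
have yP m : B (h m).1 y <= 0.
  by have := He (inl m); rewrite /= formDr formZr; lra.
have [||s s0 [sP sE]] := @normalize_chamber R Hyperbolic n k h h_data y _ _ yP.
- by [].
- split.
    rewrite /y formDl !formDr !formZl !formZr qq [form _ x q]formC.
    have := He (inr true); rewrite /= => He1.
    have : e * form Hyperbolic x x <= e * `|form Hyperbolic x x|.
      by rewrite ler_pM2l // ler_norm.
    nra.
  by have := He (inr false); rewrite /y /= !mxE; lra.
have yl m : B (h m).1 q = 0 -> B (h m).1 x = 0 -> slack (h m) (s *: y) = 0.
  by move=> mq mx; rewrite sE /y formDr formZr mq mx mulr0 addr0 mulr0.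
apply: (vertex sP); last by apply: yl => //; exact/eqP.
  by rewrite eq_sym; apply: contraNneq li => ->.
exact: yl.
Qed.

Lemma hyperbolic_nonobtuse i j : i != j -> B (h i).1 (h j).1 <= 0.
Proof.
move=> ij; rewrite leNgt; apply/negP => vij.
(* A causal vector of the cone on both walls is either ideal or, up to scale, a point of the
   chamber. Without one, [B (h j).1] is negative on the causal part of the facet [i], as
   [hyperbolic_extremum] requires. *)
have [[q [q0 qq qP qi qj]]|/forallNP noq] := pselect (exists q : 'rV[R]_n.+1,
  [/\ 0 < q 0 0, form Hyperbolic q q <= 0, forall l, B (h l).1 q <= 0,
   B (h i).1 q = 0 & B (h j).1 q = 0]).
  have [qq0|qq0] := eqVneq (form Hyperbolic q q) 0.
    by move: vij; rewrite ltNge (ideal_nonobtuse q0 qq0).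
  have [||s s0 [sP sE]] := @normalize_chamber R Hyperbolic n k h h_data q _ _
    qP.
  - by [].
  - by split=> //; rewrite lt_neqAle qq0.
  by move: vij; rewrite ltNge (vertex sP) // sE ?qi ?qj mulr0.
(* The index [None] restricts the extremum to the wall [i]. *)
pose u (o : option 'I_k) : 'rV[R]_n.+1 :=
  if o is Some l then (h l).1 else - (h i).1.
have uP (x : V) : (forall o, B (u o) x <= 0) <->
    (forall l, B (h l).1 x <= 0) /\ B (h i).1 x = 0.
  split=> [H|[H1 H2] [l|] //=]; last by rewrite formNl H2 oppr0.
  split=> [l|]; first exact: (H (Some l)).
  apply/le_anti; rewrite (H (Some i)) /=.
  by have := H None; rewrite /= formNl; lra.
have pP l m : B (h m).1 (p l) <= 0.
  rewrite -slackE; have [->|ml] := eqVneq m l; first by rewrite p_on.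
  exact/ltW/p_in.
have [pi1 pi0] := p_space i.
have [||||x [g [g0 [x0 x1] /uP[xP xi] H]]] :=
    @hyperbolic_extremum R n _ u (h j).1 (p i).
- by rewrite pi1 ltrN10.
- exact: pi0.
- by apply/uP; split=> [l|]; [exact: pP|rewrite -slackE p_on].
- move=> x x0 xx /uP[xP xi]; rewrite lt_neqAle xP andbT; apply/eqP => xj.
  by apply: (noq x); split.
have xC : chamber h x by split=> // l; rewrite slackE.
have [|||||lam [lam0 _] E] := @release_wall R Hyperbolic _ _
    (fun l => B (h l).1 x == 0) (fun l => (h l).1) i ((h j).1 - g *: x).
- exact/eqP.
- by case: (h_data i).
- move=> l /eqP xl li; apply: (vertex xC); rewrite ?slackE //.
  by rewrite eq_sym.
- by rewrite formBr formZr xi mulr0 subr0.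
- move=> w wi wA; apply: H => -[l|] /= /eqP; first exact: wA.
  by move=> _; rewrite formNl wi oppr0.
have := congr1 (fun z => B z (p j)) E;
  rewrite formBl formZl -slackE p_on sub0r form_suml.
have : \sum_(l | B (h l).1 x == 0) B (lam l *: (h l).1) (p j) <= 0.
  by apply: sumr_le0 => l _; rewrite formZl mulr_ge0_le0.
have : g * B x (p j) < 0.
  rewrite pmulr_rlt0 //; have [pj1 pj0] := p_space j.
  by apply: causal_form_lt0; rewrite ?x1 ?pj1 ?ltrN10 ?lerN10.
lra.
Qed.

End HyperbolicChamber.

(** * Common points of two walls *)

Section WallsMeet.
Variables (R : realType) (n k : nat).

(** A point of the chamber closest to [y] comes with multipliers, and [active_on_wall] puts it on
    both walls. On the sphere the closest point is taken in the cone over the chamber; in hyperbolic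
    space it is given by [hyperbolic_extremum] with [c] equal to [y]. *)
Lemma walls_meet X (h : 'I_k -> 'rV[R]_(ambient_dim X n) * R) z y i j :
  (forall i, halfspace_data (h i)) ->
  space z -> (forall i, slack (h i) z < 0) ->
  (forall i j, i != j -> form X (h i).1 (h j).1 <= 0) ->
  space y -> slack (h i) y = 0 -> slack (h j) y = 0 ->
  exists x, [/\ chamber h x, slack (h i) x = 0 & slack (h j) x = 0].
Proof.
case: X h z y => h z y h_data zX zP obt yX yi yj.
- have [//||x [c [xP c0 E]]] := @nearest_point R Euclidean _ _
  (fun l => (h l).1)
    (fun l => (h l).2) z y.
    by move=> l; rewrite -subr_le0; exact/ltW/zP.
  have xC : chamber h x by split=> // l; rewrite subr_le0.
  have {}E : y - 1 *: x = \sum_(l | slack (h l) x == 0) c l *: (h l).1.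
    by rewrite scale1r E; apply: eq_bigl => l; rewrite subr_eq0.
  by exists x; split=> //; apply: (active_on_wall h_data obt xC ltr01 _ c0 E).
- have slackE l x : slack (h l) x = form Spherical (h l).1 x.
    by rewrite /slack (h_data l).2 // subr0.
  have proj (w : 'rV[R]_n.+1) : exists x (c : 'I_k -> R),
      [/\ forall l, form Spherical (h l).1 x <= 0, forall l, 0 <= c l &
        w - x = \sum_(l | form Spherical (h l).1 x == 0) c l *: (h l).1].
    apply: (@nearest_point R Spherical _ _ _ (fun=> 0) z) => // l.
    by rewrite -slackE ltW.
  have main (w : 'rV[R]_n.+1) x (c : 'I_k -> R) :
    slack (h i) w = 0 -> slack (h j) w = 0 ->
      (forall l, form Spherical (h l).1 x <= 0) -> (forall l, 0 <= c l) ->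
      w - x = \sum_(l | form Spherical (h l).1 x == 0) c l *: (h l).1 ->
        x != 0 ->
      exists x, [/\ chamber h x, slack (h i) x = 0 & slack (h j) x = 0].
    move=> wi wj xP c0 E x0.
    have [//|//||s s0 [sP sE]] := @normalize_chamber R Spherical n k h h_data x.
      exact: xP.
    have {}E : w - s^-1 *: (s *: x) = \sum_(l | slack (h l) (s *: x) == 0) c l
      *: (h l).1.
      rewrite scalerA mulVf ?gt_eqF // scale1r E; apply: eq_bigl => l.
      by rewrite sE mulf_eq0 (gt_eqF s0).
    have s0' : 0 < s^-1 by rewrite invr_gt0.
    by exists (s *: x); split=> //;
      apply: (active_on_wall h_data obt sP s0' _ c0 E).
  have [x [c [xP c0 E]]] := proj y.
  (* If the closest point of the cone is the apex, [- y], which lies on the same two walls, is tried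
     instead. *)
  have [x0|] := eqVneq x 0; last exact: (main y x c).
  have [x' [c' [xP' c0' E']]] := proj (- y).
  have [x0'|] := eqVneq x' 0; last first.
    by apply: (main (- y) x' c'); rewrite // slackE formNr -slackE ?yi ?yj
      oppr0.
  (* Both y and -y lie in the cone of the normals, which z separates. *)
  have neg w (d : 'I_k -> R) : (forall l, 0 <= d l) ->
      w = \sum_(l | form Spherical (h l).1 0 == 0) d l *: (h l).1 ->
      form Spherical w z <= 0 /\ (form Spherical w z = 0 -> w = 0).
    move=> d0 wE.
    have T0 l : true -> 0 <= - form Spherical (d l *: (h l).1) z.
      by move=> _; rewrite oppr_ge0 formZl mulr_ge0_le0 // -slackE ltW.
    have zE : form Spherical w z = - \sum_l - form Spherical (d l *: (h l).1) z.
      rewrite sumrN opprK wE form_suml; apply: eq_bigl => l.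
      by rewrite form0r eqxx.
    rewrite zE; split; first by rewrite oppr_le0 sumr_ge0.
    move/eqP; rewrite oppr_eq0 psumr_eq0 // => /allP dz.
    rewrite wE big1 // => l _; have := dz l (mem_index_enum _).
    rewrite oppr_eq0 formZl mulf_eq0 => /orP[/eqP->|]; first by rewrite scale0r.
    by rewrite -slackE lt_eqF.
  move: E E'; rewrite x0 x0' !subr0 => E E'.
  have [y1 y2] := neg _ _ c0 E; have [y1' _] := neg _ _ c0' E'.
  have y0 : y = 0 by apply: y2; move: y1'; rewrite formNl; lra.
  by move: yX => /=; rewrite y0 form0l => /eqP; rewrite eq_sym oner_eq0.
- have slackE l x : slack (h l) x = form Hyperbolic (h l).1 x.
    by rewrite /slack (h_data l).2 // subr0.
  have [yy y0] := yX; have [zz z0] := zX.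
  have [||||x [g [g0 [x0 xx] xP H]]] :=
    @hyperbolic_extremum R n _ (fun l => (h l).1) y z.
  + by rewrite zz ltrN10.
  + by [].
  + by move=> l; rewrite -slackE ltW.
  + by move=> x x0 xx _; apply: causal_form_lt0; rewrite // yy ltrN10.
  have xC : chamber h x by split=> // l; rewrite slackE.
  have [|c c0 E] := @farkas_form R Hyperbolic _ _
    (fun l => form Hyperbolic (h l).1 x == 0)
      (fun l => (h l).1) (y - g *: x).
    by move=> w wA; apply: H => l /eqP; exact: wA.
  have {}E : y - g *: x = \sum_(l | slack (h l) x == 0) c l *: (h l).1.
    by rewrite E; apply: eq_bigl => l; rewrite slackE.
  by exists x; split=> //; apply: (active_on_wall h_data obt xC g0 _ c0 E).
Qed.

End WallsMeet.

(** * Volume of subsets of a hyperplane *)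

Section Volume.
Variable R : realType.

Lemma lebesgue_volume_set0 m : @lebesgue_volume R m set0 = 0%E.
Proof.
elim: m => [|m IH] /=; first by rewrite indicE in_set0.
by under eq_integral do rewrite [X in lebesgue_volume X](_ : _ = set0) ?IH //;
  rewrite integral0.
Qed.

(** Induction by slicing. If [v] has a nonzero entry beyond the first, every slice lies in a
    hyperplane; otherwise all slices but one are empty. *)
Lemma lebesgue_volume_hyperplane m (A : set 'rV[R]_m) (v : 'rV[R]_m) a :
  v != 0 -> A `<=` [set x | form Euclidean v x = a] -> lebesgue_volume A = 0%E.
Proof.
elim: m A v a => [|m IH] A v a v0 Av; first by rewrite thinmx0 eqxx in v0.
pose v' : 'rV[R]_m := rsubmx (v : 'rV_(1 + m)).
have formE t (x : 'rV[R]_m) :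
    form Euclidean v (row_mx (t%:M :
      'rV[R]_1) x) = v 0 0 * t + form Euclidean v' x.
  rewrite /form big_ord_recl /= !mul1r; congr (_ * _ + _).
    have -> : (ord0 : 'I_m.+1) = lshift m (0 : 'I_1) by exact: val_inj.
    by apply: etrans (row_mxEl _ _ _ _) _; rewrite mxE eqxx mulr1n.
  apply: eq_bigr => i _.
  have -> : lift ord0 i = rshift 1 i by exact: val_inj.
  rewrite !mul1r [v' 0 i]mxE; congr (_ * _); exact: row_mxEr.
rewrite /=; have [v'0|v'0] := eqVneq v' 0; last first.
  under eq_integral => t _.
    rewrite (IH _ v' (a - v 0 0 * t)) //; last first.
      by move=> x /Av /=; rewrite formE; lra.
    over.
  by rewrite integral0.
have v00 : v 0 0 != 0.
  apply: contraNneq v0 => v00; apply/eqP/rowP => i; rewrite mxE.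
  have [j ->|->//] := unliftP ord0 i.
  have -> : lift ord0 j = rshift 1 j by exact: val_inj.
  by have /rowP/(_ j) := v'0; rewrite !mxE.
set f := (X in integral _ _ X).
have -> : f = f \_ [set a / v 0 0].
  apply/funext => t; rewrite patchE; case: ifPn => // /negP tN.
  rewrite /f [X in lebesgue_volume X](_ : _ = set0) ?lebesgue_volume_set0 //.
  apply/seteqP; split=> x //= /Av /=; rewrite formE v'0 form0l addr0 => E.
  by apply: tN; rewrite inE /= -E mulrAC mulfV ?mul1r.
by rewrite -integral_mkcond integral_set1.
Qed.

Lemma volume_hyperplane X n (A : set 'rV[R]_(ambient_dim X n))
    (h : 'rV[R]_(ambient_dim X n) * R) : halfspace_data h ->
  A `<=` [set x | slack h x = 0] -> volume A = 0%E.
Proof.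
case: h => v a [/= vv aE] Av.
(* Absorbing the signs in the normal makes the hyperplane a Euclidean one. *)
pose v' := \row_i (form_sign R X i * v 0 i).
have formE x : form Euclidean v' x = form X v x.
  by apply: eq_bigr => i _; rewrite !mxE /= mul1r mulrA.
have v'0 : v' != 0.
  by apply: contra_eqN vv => /eqP v0; rewrite -formE v0 form0l eq_sym oner_eq0.
have Ev x : A x -> form Euclidean v' x = a.
  by move=> /Av; rewrite formE /slack /= => /subr0_eq.
have cE : X <> Euclidean -> cone_over A `<=` [set x | form Euclidean v' x = 0].
  move=> /aE a0 _ [t [x [_ _ Ax ->]]] /=.
  by rewrite formZr (Ev _ Ax) a0 mulr0.
case: X A v a vv aE Av v' formE v'0 Ev cE => A v a vv aE Av v' formE v'0 Ev cE;
  rewrite /volume.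
- exact: (lebesgue_volume_hyperplane v'0 Ev).
- by rewrite (lebesgue_volume_hyperplane v'0 (cE _)) ?mule0.
- by rewrite (lebesgue_volume_hyperplane v'0 (cE _)) ?mule0.
Qed.

End Volume.

(** * Facets and ridges *)

Section Flats.
Variables (R : realType) (X : space_form) (n k : nat).
Local Notation V := 'rV[R]_(ambient_dim X n).
Local Notation B := (@form R X (ambient_dim X n)).
Variable h : 'I_k -> V * R.
Hypothesis h_data : forall i, halfspace_data (h i).
Implicit Types (x y z d : V).

Definition flat (J : {pred 'I_k}) : set V :=
  [set y | space y /\ forall l, l \in J -> slack (h l) y = 0].

Definition flat_face (J : {pred 'I_k}) : set V :=
  [set y | chamber h y /\ forall l, l \in J -> slack (h l) y = 0].

Lemma flat_face_sub J : flat_face J `<=` flat J.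
Proof. by move=> y [[yX _] yJ]; split. Qed.

(** [x] is in the relative interior of the face. A short move from [x] towards a point [y] of the
    flat stays in the face, and a geodesic subspace containing both ends contains [y]. This is the
    minimality of supporting subspaces. *)
Lemma flat_sub_geodesic (J : {pred 'I_k}) x m W (L : set V) :
  chamber h x -> (forall l, slack (h l) x = 0 <-> l \in J) ->
  geodesic_subspace m W L -> flat_face J `<=` L -> flat J `<=` L.
Proof.
move=> xP xJ [_ _ [x0 x0E ->]] FL y [yX yJ].
have dP l : slack (h l) x = 0 -> B (h l).1 (direction x y) = 0.
  by move=> xl; rewrite slack_direction //; exact/yJ/xJ.
have [|z [s [e [[s0 e0] zP zE sE zact]]]] := move_in_chamber h_data xP (d :=
  direction x y).
  by move=> l /dP ->.
have [_ /= xW] : (@space R X n `&` [set x | x - x0 \in W]) x.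
  by apply: FL; split=> // l /xJ.
have [_ /= zW] : (@space R X n `&` [set x | x - x0 \in W]) z.
  by apply: FL; split=> // l /xJ xl; apply/zact; split=> //; exact: dP.
split=> //=; move: zW; rewrite zE.
have [XE|XE] := euclideanP X.
  rewrite (direction_euclidean _ _ XE) (sE XE) scale1r addrAC (rpredDl _ xW)
    rpredZeq gt_eqF //=.
  by move=> yxW; rewrite -[y - x0](subrKA x) rpredD.
rewrite (direction_linear _ _ XE) (x0E XE) !subr0 rpredZeq (gt_eqF s0) /=
  rpredDl; last first.
  by move: xW; rewrite (x0E XE) subr0.
by rewrite rpredZeq gt_eqF.
Qed.

Lemma flat_geodesic r (u : 'I_r -> 'I_k) x m : flat [in codom u] x ->
  ambient_dim X m = (ambient_dim X n - r)%N ->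
  (forall t : 'rV[R]_r, exists w, forall e, B (h (u e)).1 w = t 0 e) ->
  geodesic_subspace m (annihilator X
    (fun e => (h (u e)).1)) (flat [in codom u]).
Proof.
move=> [xX xJ] mE surj; split; first by rewrite dim_annihilator.
  by exists x.
have [XE|XE] := euclideanP X.
  exists x => //; apply/seteqP; split=> y [yX /= yJ]; split=> //=.
    apply/annihilatorP => e; have ue : u e \in codom u by exact: codom_f.
    by have := yJ _ ue; have := xJ _ ue; rewrite /slack formBr; lra.
  move=> l /codomP[e ->]; have := annihilatorP _ _ _ yJ e.
  by have := xJ _ (codom_f u e); rewrite /slack formBr; lra.
exists 0 => //; apply/seteqP; split=> y [yX /= yJ]; split=> //=.
  apply/annihilatorP => e; have := yJ _ (codom_f u e).
  by rewrite /slack (h_data _).2 // !subr0.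
move=> l /codomP[e ->]; have := annihilatorP _ _ _ yJ e.
by rewrite /slack (h_data _).2 // !subr0.
Qed.

Lemma flat_supporting r (u : 'I_r -> 'I_k) x m : chamber h x ->
  (forall l, slack (h l) x = 0 <-> l \in codom u) ->
  ambient_dim X m = (ambient_dim X n - r)%N ->
  (forall t : 'rV[R]_r, exists w, forall e, B (h (u e)).1 w = t 0 e) ->
  supporting_subspace (flat_face [in codom u]) m
    (annihilator X (fun e => (h (u e)).1)) (flat [in codom u]).
Proof.
move=> xP xJ mE surj; split.
- by apply: (flat_geodesic (x := x)) => //; split=> [|l /xJ //]; case: xP.
- exact: flat_face_sub.
- by move=> m' W' L'; apply: (flat_sub_geodesic xP).
Qed.

(** A point of [L] moved slightly along [w] in [W] stays in [L], hence in [L']; so [W] is contained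
    in [W'], and the dimensions agree. *)
Lemma geodesic_eq m W W' (L L' : set V) :
  geodesic_subspace m W L -> geodesic_subspace m W' L' -> L `<=` L' -> L = L'.
Proof.
move=> [dW [x Lx] [x0 x0E LE]] [dW' _ [x0' x0E' LE']] LL'.
have [xX /= xW] : (@space R X n `&` [set x | x - x0 \in W]) x by rewrite -LE.
have [_ /= xW'] : (@space R X n `&` [set x | x - x0' \in W']) x by rewrite
  -LE'; exact: LL'.
suff WW' : W = W'.
  apply/seteqP; split=> // y; rewrite LE LE' WW' => -[yX /= yW]; split=> //=.
  have [XE|XE] := euclideanP X; last by move: yW; rewrite (x0E XE) (x0E' XE).
  have -> : y - x0 = (y - x0') - (x - x0') + (x - x0).
    by rewrite opprB !subrKA.
  by apply: rpredD; [exact: rpredB|rewrite -WW'].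
apply/eqP; rewrite eqEdim dW dW' leqnn andbT; apply/subvP => w wW.
have [e0 e00 He0] := admissible_near w xX.
have [|s [s0 sE zX]] := @normalize_space R n X (x + e0 *: w).
  by apply: He0; rewrite lexx ltW.
have : L (s *: (x + e0 *: w)).
  rewrite LE; split=> //=; have [XE|XE] := euclideanP X.
    by rewrite (sE XE) scale1r addrAC rpredD // rpredZ.
  by move: xW; rewrite (x0E XE) !subr0 => xW;
    rewrite rpredZ // rpredD // rpredZ.
move/LL'; rewrite LE' => -[_ /=]; have [XE|XE] := euclideanP X.
  by rewrite (sE XE) scale1r addrAC rpredDl // rpredZeq gt_eqF.
rewrite (x0E' XE) subr0 rpredZeq (gt_eqF s0) /= rpredDl.
  by rewrite rpredZeq gt_eqF.
by move: xW'; rewrite (x0E' XE) subr0.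
Qed.

End Flats.

Section Faces.
Variables (R : realType) (X : space_form) (n : nat).
Local Notation V := 'rV[R]_(ambient_dim X n).
Local Notation B := (@form R X (ambient_dim X n)).
Implicit Types (x y z d : V).

Lemma halfspaceP g y : halfspace g y <-> space y /\ slack g y <= 0.
Proof. by rewrite /halfspace /slack subr_le0; split. Qed.

Lemma halfspace_boundaryP g y : halfspace_boundary g y <-> space y /\ slack g y
  = 0.
Proof.
by split=> -[yX /= E]; split=> //=; [rewrite /slack E subrr|exact/subr0_eq].
Qed.

Hypothesis n2 : (2 <= n)%N.

Lemma ambient_dim_hyperplane : ambient_dim X n.-1 = (ambient_dim X n - 1)%N.
Proof. by case: X => /=; lia. Qed.

Lemma ambient_dim_ridge : ambient_dim X n.-2 = (ambient_dim X n - 2)%N.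
Proof. by case: X => /=; lia. Qed.

Lemma mem_codom1 k (i l : 'I_k) : l \in codom (fun _ : 'I_1 => i) <-> l = i.
Proof. by split=> [/codomP[]//|->]; exact: (codom_f (fun _ : 'I_1 => i) 0). Qed.

Lemma normal_surjective k (g : 'I_k -> V * R) i : halfspace_data (g i) ->
  forall t : 'rV[R]_1, exists w, forall e : 'I_1, B (g i).1 w = t 0 e.
Proof.
move=> [vv _] t; exists (t 0 0 *: (g i).1) => e.
by rewrite formZr vv mulr1 (ord1 e).
Qed.

Lemma boundary_geodesic (g : V * R) x : halfspace_data g -> space x ->
  slack g x = 0 ->
  geodesic_subspace n.-1 (annihilator X (fun _ : 'I_1 => g.1))
    [set y | space y /\ slack g y = 0].
Proof.
move=> gd xX xg; pose u : 'I_1 -> 'I_1 := fun=> 0.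
have -> : [set y | space y /\ slack g y = 0] = flat (fun=> g) [in codom u].
  apply/seteqP; split=> y [yX yg]; split=> //.
  by apply: (yg 0); exact: (codom_f u 0).
apply: (@flat_geodesic _ _ _ _ (fun=> g) _ _ u x) => //.
- exact: ambient_dim_hyperplane.
- exact: (@normal_surjective 1 (fun=> g) 0).
Qed.

End Faces.

(** * Walls and facets *)

Section Walls.
Variables (R : realType) (X : space_form) (n k : nat).
Local Notation V := 'rV[R]_(ambient_dim X n).
Local Notation B := (@form R X (ambient_dim X n)).
Implicit Types (x y z d : V).
Hypothesis n2 : (2 <= n)%N.

Definition wall (h : 'I_k -> V * R) i : set V :=
  [set y | chamber h y /\ slack (h i) y = 0].

Variable h : 'I_k -> V * R.
Hypothesis h_data : forall i, halfspace_data (h i).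

Let u1 (i : 'I_k) : 'I_1 -> 'I_k := fun=> i.

Lemma wallE i : wall h i = flat_face h [in codom (u1 i)].
Proof.
apply/seteqP; split=> y [yP yi]; split=> //.
  by move=> l /mem_codom1->.
exact/yi/mem_codom1.
Qed.

Lemma flat1E i : flat h [in codom (u1 i)] = [set y | space y /\ slack (h i) y =
  0].
Proof.
apply/seteqP; split=> y [yX yi]; split=> //; first exact/yi/mem_codom1.
by move=> l /mem_codom1->.
Qed.

Lemma wall_supporting i x : chamber h x ->
  (forall l, slack (h l) x = 0 <-> l = i) ->
  supporting_subspace (wall h i) n.-1 (annihilator X (fun e :
    'I_1 => (h (u1 i e)).1))
    [set y | space y /\ slack (h i) y = 0].
Proof.
move=> xP xi; rewrite -flat1E wallE; apply: (flat_supporting h_data xP).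
- by move=> l; rewrite xi; split=> /mem_codom1.
- exact: ambient_dim_hyperplane.
- exact: normal_surjective.
Qed.

(** Rescaled sums of points that avoid the successive walls end up avoiding all of them. *)
Lemma strict_point (F : set V) : F !=set0 -> F `<=` chamber h ->
  (forall x y z s, F x -> F y -> space z -> 0 < s ->
    (forall g, halfspace_data g -> slack g z = s * (slack g x + slack g y)) ->
      F z) ->
  (forall i, exists2 x, F x & slack (h i) x < 0) ->
  exists2 x, F x & forall i, slack (h i) x < 0.
Proof.
move=> [x0 Fx0] FP Fconv H.
suff [x Fx xs] : exists2 x, F x & forall i,
  i \in enum 'I_k -> slack (h i) x < 0.
  by exists x => // i; rewrite xs // mem_enum.
elim: (enum 'I_k) => [|i s [x Fx xs]]; first by exists x0.
have [xi|xi] := ltP (slack (h i) x) 0.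
  by exists x => // j; rewrite in_cons => /predU1P[->//|]; exact: xs.
have [y Fy yi] := H i.
have [[xX xP] [yX yP]] := (FP _ Fx, FP _ Fy).
have [|z [r [r0 zX zE]]] := combine xX yX (@ltr01 R) (@ltr01 R).
  (* On the sphere the sum is nonzero, since [slack (h i)] is negative at [y] and nonpositive at
     [x]. *)
  move=> XS; have XE : X <> Euclidean by rewrite XS.
  apply: contraTneq yi => /(congr1 (B (h i).1)).
  have slackE w : slack (h i) w = B (h i).1 w.
    by rewrite /slack (h_data i).2 // subr0.
  by rewrite !scale1r formDr form0r -!slackE -leNgt => E; have := xP i; lra.
have {}zE g : halfspace_data g -> slack g z = r * (slack g x + slack g y).
  by move=> gd; rewrite zE // !mul1r.
exists z; first exact: (Fconv x y z r).
move=> j; rewrite in_cons zE // pmulr_rlt0 // => /predU1P[->|/xs xj].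
  by have := xP i; lra.
by have := yP j; lra.
Qed.

Variables (p : 'I_k -> V).
Hypothesis p_space : forall i, space (p i).
Hypothesis p_on : forall i, slack (h i) (p i) = 0.
Hypothesis p_in : forall i j, j != i -> slack (h j) (p i) < 0.

Let pP i : chamber h (p i) := p_chamber p_space p_on p_in i.

Let p_active i l : slack (h l) (p i) = 0 <-> l = i.
Proof.
split=> [pl|->//]; apply/eqP/negPn/negP => li.
by have := p_in li; rewrite pl ltxx.
Qed.

Lemma wall_facet i : facet (chamber h) (wall h i).
Proof.
split; last by do 2 eexists; exact: (wall_supporting (pP i) (p_active i)).
split; first by exists (p i); split=> //; exact: pP.
exists (h i); split=> //; first by move=> y [yX yP]; apply/halfspaceP.
apply/seteqP; split=> y [yP yi]; split=> //;
  first by apply/halfspace_boundaryP; case: yP.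
by case/halfspace_boundaryP: yi.
Qed.

Lemma wall_inj i j : wall h i = wall h j -> i = j.
Proof.
by move=> ij; have : wall h i (p i) by []; rewrite ij => -[_ /p_active].
Qed.

Lemma wall_hyperplane i L : supporting_hyperplane (wall h i) L ->
  L = [set y | space y /\ slack (h i) y = 0].
Proof.
move=> [W [WL _ Lmin]]; have pi := p_on i.
have bd := boundary_geodesic n2 (h_data i) (p_space i) pi.
apply: (geodesic_eq WL bd); apply: (Lmin _ _ _ bd).
by move=> y [[yX _] yi].
Qed.

(** If [F] lay in no wall, [strict_point] would give a point of [F] strictly inside all of them, and
    a short move along the normal of [g] would leave the half-space [g] but not the chamber. So [F]
    lies in some wall [i], and by dimension the boundaries of [g] and [h i] both equal the
    supporting subspace of [F]. *)
Lemma facet_wall F : facet (chamber h) F -> exists i, F = wall h i.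
Proof.
move=> [[F0 [g [gd Pg FE]]] [W [L [WL FL Lmin]]]].
have FP : F `<=` chamber h by rewrite FE => y [].
have [i Fi] : exists i, F `<=` wall h i.
  apply: contrapT => /forallNP H.
  have [||||x Fx xs] := @strict_point F.
  - exact: F0.
  - exact: FP.
  - move=> x y z s; rewrite FE => -[[xX xP] /halfspace_boundaryP[_ xg]].
    move=> [[yX yP] /halfspace_boundaryP[_ yg]] zX s0 zE; split.
      by split=> // l; rewrite zE // pmulr_rle0 //; have := xP l;
        have := yP l; lra.
    by apply/halfspace_boundaryP; rewrite zE // xg yg addr0 mulr0.
  - move=> i; have /existsNP[x /not_implyP[Fx xi]] := H i.
    exists x => //; have xP := FP _ Fx; rewrite lt_neqAle; case: (xP) => _ ->.
    by rewrite andbT; apply/eqP => xi0; apply: xi.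
  have := Fx; rewrite FE => -[xP /halfspace_boundaryP[_ xg]].
  have [|z [s [e [[s0 e0] zP zE sE _]]]] := move_in_chamber h_data xP (d :=
    g.1).
    by move=> i xi; have := xs i; rewrite xi ltxx.
  have /Pg/halfspaceP[_] := zP.
  rewrite zE slackZ // pmulr_rle0 // /slack formDr formZr gd.1 mulr1 addrAC.
  by move: xg; rewrite /slack => ->; lra.
exists i; have [x Fx] := F0; have [xP xi] := Fi _ Fx.
have xg : slack g x = 0 by move: Fx; rewrite FE => -[_ /halfspace_boundaryP[]].
have bdi := boundary_geodesic n2 (h_data i) xP.1 xi.
have Li : L = [set y | space y /\ slack (h i) y = 0].
  apply: (geodesic_eq WL bdi); apply: (Lmin _ _ _ bdi).
  by move=> y /Fi[[yX _] yi].
have bdg := boundary_geodesic n2 gd xP.1 xg.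
have Lg : L = [set y | space y /\ slack g y = 0].
  apply: (geodesic_eq WL bdg); apply: (Lmin _ _ _ bdg).
  by move=> y; rewrite FE => -[_ /halfspace_boundaryP].
have LE y : (space y /\ slack (h i) y = 0) <-> (space y /\ slack g y = 0).
  have := congr1 (fun A : set V => A y) Li; rewrite Lg /= => ->.
  by split.
rewrite FE; apply/seteqP; split=> y [yP].
  move=> /halfspace_boundaryP yg; split=> //.
  by case: ((LE y).2 yg).
move=> yi; split=> //; apply/halfspace_boundaryP/LE; split=> //; exact: yP.1.
Qed.

End Walls.

(** * Ridges and dihedral angles *)

Section Ridges.
Variables (R : realType) (X : space_form) (n k : nat).
Local Notation V := 'rV[R]_(ambient_dim X n).
Local Notation B := (@form R X (ambient_dim X n)).
Implicit Types (x y z d : V).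
Hypothesis n2 : (2 <= n)%N.
Variable h : 'I_k -> V * R.
Hypothesis h_data : forall i, halfspace_data (h i).
Variables (p : 'I_k -> V).
Hypothesis p_space : forall i, space (p i).
Hypothesis p_on : forall i, slack (h i) (p i) = 0.
Hypothesis p_in : forall i j, j != i -> slack (h j) (p i) < 0.

Section TwoWalls.
Variables (x : V) (i j : 'I_k).
Hypotheses (xP : chamber h x) (ij : i != j).
Hypothesis x_active : forall l, slack (h l) x = 0 <-> l = i \/ l = j.

Let u (e : 'I_2) := if e == 0 then i else j.
Let G := B (h i).1 (h j).1.
Let xi : slack (h i) x = 0. Proof. by apply/x_active; left. Qed.
Let xj : slack (h j) x = 0. Proof. by apply/x_active; right. Qed.

Lemma mem_codom2 l : l \in codom u <-> l = i \/ l = j.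
Proof.
split=> [/codomP[e ->]|[]->]; first by rewrite /u; case: ifP; [left|right].
  exact: (codom_f u 0).
exact: (codom_f u 1).
Qed.

Lemma ridge_surjective (t : 'rV[R]_2) :
  exists w, forall e, B (h (u e)).1 w = t 0 e.
Proof.
have ai : slack (h j) (p i) < 0 by apply: p_in; rewrite eq_sym.
have aj : slack (h i) (p j) < 0 by exact: p_in.
(* [p j] is on the wall [j] and off the wall [i], and conversely, so the two directions are up to
   scale dual to the normals. *)
exists ((t 0 0 / slack (h i) (p j)) *: direction x (p j) +
        (t 0 1 / slack (h j) (p i)) *: direction x (p i)) => e.
rewrite formDr !formZr; case: (unliftP 0 e) => [f ->|->].
  have -> : lift 0 f = 1 :> 'I_2 by apply: val_inj; rewrite /= (ord1 f).
  by rewrite /u /= !slack_direction // p_on mulr0 add0r divfK // lt_eqF.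
by rewrite /u /= !slack_direction // p_on mulr0 addr0 divfK // lt_eqF.
Qed.

(** [1 - G ^+ 2] is the square of the component of one normal orthogonal to the other; pairing with
    the direction to [p i] shows that this component is nonzero. *)
Lemma ridge_gram_lt1 : G ^+ 2 < 1.
Proof.
have : 0 < B ((h j).1 - G *: (h i).1) ((h j).1 - G *: (h i).1).
  apply: (posdef_at (x := x)); first by case: xP.
    move=> XH; have XE : X <> Euclidean by rewrite XH.
    move: xi xj; rewrite /slack !(h_data _).2 // !subr0 formBl formZl => -> ->.
    by rewrite mulr0 subr0.
  have ai : slack (h j) (p i) < 0 by apply: p_in; rewrite eq_sym.
  apply: contraTneq ai => /(congr1 (fun w => B w (direction x (p i)))).
  by rewrite formBl formZl !slack_direction // p_on mulr0 subr0 form0l => ->;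
    rewrite ltxx.
rewrite formBl !formBr !formZl !formZr [B (h j).1 (h i).1]formC -/G.
rewrite (h_data i).1 (h_data j).1; lra.
Qed.

Let Q := flat_face h [in codom u].

Lemma ridge_supporting :
  supporting_subspace Q n.-2 (annihilator X
    (fun e => (h (u e)).1)) (flat h [in codom u]).
Proof.
apply: (flat_supporting h_data xP).
- by move=> l; rewrite x_active mem_codom2.
- exact: ambient_dim_ridge.
- exact: ridge_surjective.
Qed.

Lemma ridge_ij : ridge (chamber h) Q.
Proof.
split; last by do 2 eexists; exact: ridge_supporting.
split.
  by exists x; split=> // l /mem_codom2/x_active.
have G1 := ridge_gram_lt1.
have c0 : 0 < 2 + 2 * G by nra.
pose c := (Num.sqrt (2 + 2 * G))^-1.
have cp : 0 < c by rewrite invr_gt0 sqrtr_gt0.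
(* The normalized sum of the two half-spaces; its boundary touches the chamber exactly where both
   slacks vanish. *)
pose g : V * R := (c *: ((h i).1 + (h j).1), c * ((h i).2 + (h j).2)).
have gE y : slack g y = c * (slack (h i) y + slack (h j) y).
  by rewrite /slack /g /= formZl formDl; ring.
exists g; split.
- split=> /=; last by move=> XE; rewrite !(h_data _).2 // addr0 mulr0.
  rewrite formZl formZr formDl !formDr [B (h j).1 (h i).1]formC -/G.
  rewrite (h_data i).1 (h_data j).1 mulrA -expr2 exprVn sqr_sqrtr;
    last exact: ltW.
  by rewrite (_ : 1 + G + _ = 2 + 2 * G); [rewrite mulVf // gt_eqF|ring].
- move=> y [yX yP]; apply/halfspaceP; split=> //; rewrite gE pmulr_rle0 //.
  by have := yP i; have := yP j; lra.
- apply/seteqP; split=> y [yP yg]; split=> //.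
    apply/halfspace_boundaryP; split; first by case: yP.
    have -> : slack g y = 0; last by [].
    rewrite gE (yg i) ?(yg j) ?addr0 ?mulr0 //; apply/mem_codom2;
      first by right.
    by left.
  have /halfspace_boundaryP[_] := yg; rewrite gE => /eqP.
  rewrite mulf_eq0 gt_eqF //= => /eqP E l /mem_codom2 lij.
  by case: yP => _ yP; have := yP i; have := yP j; case: lij => ->; lra.
Qed.

(** The vector is the normalized component of [- (h b).1] orthogonal to [(h a).1]. *)
Lemma ridge_conormal a b :
  (a = i /\ b = j) \/ (a = j /\ b = i) ->
  inner_conormal (wall h a) Q
    ((Num.sqrt (1 - G ^+ 2))^-1 *: (G *: (h a).1 - (h b).1)).
Proof.
move=> abE; have G1 := ridge_gram_lt1.
have s0 : 0 < 1 - G ^+ 2 by lra.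
have ab : B (h a).1 (h b).1 = G.
  by case: abE => -[-> ->] //; rewrite formC.
have [Qa Qb] : a \in codom u /\ b \in codom u.
  by split; apply/mem_codom2; case: abE => -[aE bE];
    [left|right|right|left].
have p_act l : slack (h l) (p a) = 0 <-> l = a.
  split=> [pl|->//]; apply/eqP/negPn/negP => la.
  by have := p_in la; rewrite pl ltxx.
exists (annihilator X (fun _ : 'I_1 => (h a).1)),
  [set y | space y /\ slack (h a) y = 0],
  (annihilator X (fun e => (h (u e)).1)), (flat h [in codom u]); split.
- exact: (wall_supporting n2 h_data (p_chamber p_space p_on p_in a) p_act).
- exact: ridge_supporting.
split.
- apply/annihilatorP => _; rewrite formZr formBr formZr (h_data a).1 ab.
  by rewrite mulr1 subrr mulr0.
- move=> w /annihilatorP wQ.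
  have [/codomP[e ae] /codomP[f bf]] := (Qa, Qb).
  by rewrite formZl formBl formZl ae bf !wQ mulr0 subrr mulr0.
- rewrite formZl formZr formBl !formBr !formZl !formZr [B (h b).1 (h a).1]formC
  ab.
  rewrite (h_data a).1 (h_data b).1 mulrA -expr2 exprVn sqr_sqrtr;
    last exact: ltW.
  rewrite (_ : _ - _ = 1 - G ^+ 2); first by rewrite mulVf // gt_eqF.
  ring.
- move=> y q [yP ya] [qP qJ]; rewrite formZl formBl formZl !formBr.
  apply: mulr_ge0; first by rewrite invr_ge0 sqrtr_ge0.
  have := qJ _ Qa; have := qJ _ Qb; have := yP.2 b; move: ya;
    rewrite /slack => *.
  have -> : B (h a).1 y - B (h a).1 q = 0 by lra.
  lra.
Qed.

Lemma ridge_dihedral_angle : dihedral_angle (chamber h) Q (acos (- G)).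
Proof.
have G1 := ridge_gram_lt1.
have [G2 G3] : -1 < - G /\ - G < 1 by split; nra.
have s0 : 0 < 1 - G ^+ 2 by lra.
have F := @wall_facet R X n k n2 h h_data p p_space p_on p_in.
exists (wall h i), (wall h j); split.
  split; [exact: F|exact: F| | |].
  - move=> /(wall_inj p_space p_on p_in)/eqP; exact/negP.
  - by move=> y [yP yQ]; split=> //; apply: yQ; apply/mem_codom2; left.
  - by move=> y [yP yQ]; split=> //; apply: yQ; apply/mem_codom2; right.
do 2 eexists; split.
- by apply: ridge_conormal; left; split.
- by apply: ridge_conormal; right; split.
- by rewrite acos_gt0 // G3 ltW.
- by rewrite acos_ltpi // G2 ltW.
rewrite acosK; last by rewrite in_itv /= !ltW.
rewrite formZl formZr formBl !formBr !formZl !formZr [B (h j).1 (h i).1]formC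
  -/G.
rewrite (h_data i).1 (h_data j).1 mulrA -expr2 exprVn sqr_sqrtr;
  last exact: ltW.
by field; rewrite gt_eqF.
Qed.

Lemma ridge_nonobtuse :
  (forall Q theta, ridge (chamber h) Q -> dihedral_angle (chamber h) Q theta ->
    theta <= pi / 2) -> G <= 0.
Proof.
move=> /(_ _ _ ridge_ij ridge_dihedral_angle) le_pi2.
have G1 := ridge_gram_lt1.
have [G2 G3] : -1 <= - G /\ - G <= 1 by split; nra.
have : 0 <= cos (acos (- G)).
  apply: cos_ge0_pihalf; rewrite le_pi2 andbT (le_trans _ (acos_ge0 _)) ?G2 //.
  by rewrite oppr_le0 divr_ge0 // pi_ge0.
by rewrite acosK ?oppr_ge0 // in_itv /= G2.
Qed.

End TwoWalls.
End Ridges.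

(** * Minimal families of half-spaces *)

Section MinimalFamily.
Variables (R : realType) (X : space_form) (n : nat).
Local Notation V := 'rV[R]_(ambient_dim X n).
Local Notation B := (@form R X (ambient_dim X n)).
Implicit Types (x y z d : V).

Lemma halfspaces_interP (S : set (V * R)) y :
  halfspaces_inter S y <-> space y /\ forall g, S g -> slack g y <= 0.
Proof.
split=> [[yX yS]|[yX yS]]; split=> // g Sg;
  first by have /halfspaceP[] := yS g Sg.
by apply/halfspaceP; split=> //; exact: yS.
Qed.

Lemma halfspaces_inter_range k (h : 'I_k -> V * R) :
  halfspaces_inter (range h) = chamber h.
Proof.
apply/seteqP; split=> y; first by move=> /halfspaces_interP[yX yP];
  split=> // i; apply: yP; exists i.
by move=> [yX yP]; apply/halfspaces_interP; split=> // _ [i _ <-].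
Qed.

Lemma volume_set0 : volume (set0 : set V) = 0%E.
Proof.
have cone0 : cone_over (set0 : set V) = set0.
  by apply/seteqP; split=> y // [t [x []]].
by rewrite /volume cone0 lebesgue_volume_set0 mule0; case: X.
Qed.

Lemma undup_size_uniq (T : eqType) (s : seq T) :
  (size s <= size (undup s))%N -> uniq s.
Proof. by move=> H; rewrite -[uniq s]negbK -ltn_size_undup -leqNgt. Qed.

(** A list of least length among those defining [P] is also minimal for inclusion. *)
Lemma minimal_family (P : set V) (S : set (V * R)) : finite_set S ->
  S `<=` @halfspace_data R X n -> P = halfspaces_inter S ->
  exists k (h : 'I_k -> V * R), minimal_halfspaces P h.
Proof.
move=> /finite_seqP[s0 SE] Sd PE.
pose good m := exists s : seq (V * R), [/\ size s = m,
  [set` s] `<=` @halfspace_data R X n & P = halfspaces_inter [set` s]].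
have good0 : exists m, `[< good m >].
  by exists (size s0); apply/asboolP; exists s0; rewrite -SE.
case: (ex_minnP good0) => m /asboolP[s [sm sd sP]] mmin.
have s_min s' : {subset s' <= s} -> P = halfspaces_inter [set` s'] ->
    (size s <= size s')%N.
  move=> s's Ps'; rewrite sm; apply: mmin; apply/asboolP; exists s'; split=> //.
  by move=> g /= /s's; exact: sd.
have s_uniq : uniq s.
  apply: undup_size_uniq; apply: s_min => [g|]; first by rewrite mem_undup.
  by rewrite sP; congr halfspaces_inter; apply/seteqP; split=> g /=;
    rewrite mem_undup.
pose h := tnth (in_tuple s).
have hE : range h = [set` s].
  apply/seteqP; split=> g /=; first by move=> [i _ <-]; exact: mem_tnth.
  by move=> /(tnthP (in_tuple s))[i ->]; exists i.
exists (size s), h; split.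
- exact/tuple_uniqP.
- by move=> i; apply: sd; exact: mem_tnth.
- by rewrite hE.
- move=> S' S'h PS'; apply/seteqP; split=> // g; rewrite hE /= => gs.
  apply: contrapT => gS'.
  pose s' := [seq f <- s | `[< S' f >]].
  have s'E : S' = [set` s'].
    apply/seteqP; split=> f /=; rewrite mem_filter.
      by move=> S'f; rewrite asboolT //; have := S'h _ S'f; rewrite hE.
    by move=> /andP[/asboolP].
  have := s_min s' (fun f => _); rewrite -s'E => /(_ _ PS') H.
  have {}H : (size s <= size s')%N by apply: H => f;
    rewrite mem_filter => /andP[].
  move: H; rewrite leqNgt size_filter => /negP; apply.
  rewrite -(count_predC (fun f => `[< S' f >]) s) -[ltnLHS]addn0 ltn_add2l
    -has_count.
  by apply/hasP; exists g => //=; rewrite asboolF.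
Qed.

Hypothesis n2 : (2 <= n)%N.
Variables (k : nat) (h : 'I_k -> V * R).
Hypothesis h_data : forall i, halfspace_data (h i).

(** A wall containing the whole chamber would force its volume to vanish, so [strict_point]
    applies. *)
Lemma interior_point : (0 < volume (chamber h))%E ->
  exists2 z, chamber h z & forall i, slack (h i) z < 0.
Proof.
move=> vol; apply: (strict_point h_data) => //.
- by apply/set0P/eqP => P0; move: vol; rewrite P0 volume_set0 ltxx.
- move=> x y z s [xX xP] [yX yP] zX s0 zE; split=> // i.
  by rewrite zE // pmulr_rle0 //; have := xP i; have := yP i; lra.
- move=> i; apply: contrapT => H; move: vol.
  rewrite (volume_hyperplane (h_data i)) ?ltxx // => x xP /=.
  apply/le_anti; rewrite xP.2 /= leNgt; apply/negP => xi; apply: H.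
  by exists x.
Qed.

(** By minimality some [y] violates only the wall [i]; the segment from [y] to the interior point
    [z] crosses that wall strictly inside the others. *)
Lemma wall_point z i : injective h ->
  (forall S, S `<=` range h -> chamber h = halfspaces_inter S -> S = range h) ->
  chamber h z -> (forall i, slack (h i) z < 0) ->
  exists x, [/\ space x, slack (h i) x = 0 & forall j,
    j != i -> slack (h j) x < 0].
Proof.
move=> h_inj h_min [zX zP] z_lt.
pose S := [set h l | l in [set l | l != i]].
have [y [yX yi yP]] : exists y, [/\ space y, 0 < slack (h i) y &
    forall j, j != i -> slack (h j) y <= 0].
  apply: contrapT => /forallNP H.
  have [l /= li /h_inj li'] : S (h i).
  - rewrite (h_min S); first by exists i.
      by move=> _ [l _ <-]; exists l.
    apply/seteqP; split=> y; last first.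
      move=> /halfspaces_interP[yX yS]; split=> // l.
      have [->|li] := eqVneq l i; last by apply: yS; exists l.
      rewrite leNgt; apply/negP => yi; apply: (H y); split=> // j ji.
      by apply: yS; exists j.
    by move=> [yX yP]; apply/halfspaces_interP; split=> // _ [l _ <-].
  by rewrite li' eqxx in li.
have slackE l w : X <> Euclidean -> slack (h l) w = B (h l).1 w.
  by move=> XE; rewrite /slack (h_data l).2 // subr0.
have zi : 0 < - slack (h i) z by rewrite oppr_gt0.
(* The weights make the slack of [i] cancel. If the combination vanishes, [y] and [z] are antipodal,
   and then [i] is the only wall. *)
have [[XS yz0]|nz] := pselect (X = Spherical /\
    (- slack (h i) z) *: y + slack (h i) y *: z = 0); last first.
  have [|x [s [s0 xX xE]]] := combine yX zX zi yi.
    by move=> XS; apply/eqP => yz0; apply: nz.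
  exists x; split=> //; first by rewrite xE //; ring.
  move=> j ji; rewrite xE // pmulr_rlt0 //.
  have : - slack (h i) z * slack (h j) y <= 0 by rewrite pmulr_rle0 // yP.
  have : slack (h i) y * slack (h j) z < 0 by rewrite pmulr_rlt0.
  lra.
have XE : X <> Euclidean by rewrite XS.
have alone j : j = i.
  apply/eqP/negPn/negP => ji; have := congr1 (B (h j).1) yz0.
  rewrite formDr !formZr form0r -!slackE //.
  have : - slack (h i) z * slack (h j) y <= 0 by rewrite pmulr_rle0 // yP.
  have : slack (h i) y * slack (h j) z < 0 by rewrite pmulr_rlt0.
  lra.
have [|w w0 wE] := @annihilator_neq0 R X (ambient_dim X n) 1 (fun=> (h i).1).
  by case: (X) n2 => /= ?; lia.
have [s [s0 _ wX]] := normalize_space (admissible_spherical XS w0).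
exists (s *: w); split=> //; first by rewrite slackE // formZr (wE 0) mulr0.
by move=> j; rewrite (alone j) eqxx.
Qed.

End MinimalFamily.

(** * From minimal families to facets and Gram matrices *)

Theorem theorem12 (R : realType) (X : space_form) (n : nat)
    (P : set 'rV[R]_(ambient_dim X n)) :
  (2 <= n)%N -> polyhedron P ->
  (forall (Q : set 'rV[R]_(ambient_dim X n)) (theta : R),
      ridge P Q -> dihedral_angle P Q theta -> theta <= pi / 2) ->
  (forall F1 F2 L1 L2 : set 'rV[R]_(ambient_dim X n),
      facet P F1 -> facet P F2 -> F1 <> F2 ->
      supporting_hyperplane F1 L1 -> supporting_hyperplane F2 L2 ->
      (F1 `&` F2 !=set0 <-> L1 `&` L2 !=set0)) /\
  non_obtuse P.
Proof.
move=> n2 [[S [Sfin Sd PS]] vol _ _] angles.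
have points k (h : 'I_k -> 'rV[R]_(ambient_dim X n) * R) :
  minimal_halfspaces P h ->
    [/\ P = chamber h,
     exists2 z, chamber h z & forall i, slack (h i) z < 0 &
     exists p : 'I_k -> 'rV[R]_(ambient_dim X n), [/\ forall i, space (p i),
       forall i, slack (h i) (p i) = 0 & forall i j,
         j != i -> slack (h j) (p i) < 0]].
  rewrite /minimal_halfspaces halfspaces_inter_range => -[h_inj h_data PE].
  rewrite PE => h_min.
  have [z zP z_lt] : exists2 z, chamber h z & forall i, slack (h i) z < 0.
    by apply: (interior_point h_data); rewrite -PE.
  split=> //; first by exists z.
  have /choice[p pE] i := wall_point n2 h_data i h_inj h_min zP z_lt.
  by exists p; split=> i; case: (pE i).
(* Non-obtuseness is obtained first, for every minimal family; the intersection of facets is deduced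
   from it through [walls_meet]. *)
have obtuse k (h : 'I_k -> 'rV[R]_(ambient_dim X n) * R) :
  minimal_halfspaces P h ->
    forall i j, i != j -> form X (h i).1 (h j).1 <= 0.
  move=> h_min; have [PE _ [p [p_space p_on p_in]]] := points _ _ h_min.
  case: h_min => _ h_data _ _ i j ij.
  have ridges x a b : chamber h x -> a != b ->
      (forall l, slack (h l) x = 0 <-> l = a \/ l = b) ->
        form X (h a).1 (h b).1 <= 0.
    move=> xP ab xab; apply: (ridge_nonobtuse n2 h_data p_space p_on p_in xP ab
      xab).
    by rewrite -PE.
  have [XE|[XS|XH]] : X = Euclidean \/ X = Spherical \/ X = Hyperbolic.
    by case: (X); [left|right; left|right; right].
  - exact: (euclidean_nonobtuse h_data p_space p_on p_in ridges XE ij).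
  - exact: (spherical_nonobtuse h_data p_on p_in ridges n2 XS ij).
  - have := vertex_nonobtuse h_data p_on p_in ridges.
    clear -XH h_data p_space p_on p_in ij; subst X => vertex.
    exact: (hyperbolic_nonobtuse h_data p_space p_on p_in vertex ij).
split; last by move=> k h h_min i j ij; rewrite mxE; exact: obtuse h_min i j ij.
have [k [h h_min]] := minimal_family Sfin Sd PS.
have [PE [z zP z_lt] [p [p_space p_on p_in]]] := points _ _ h_min.
have obt := obtuse _ _ h_min; case: h_min => _ h_data _ _.
rewrite PE => F1 F2 L1 L2 fF1 fF2 F12 sL1 sL2; split.
  move=> [x [x1 x2]]; exists x; split.
    by case: sL1 => W [_ FL _]; exact: FL.
  by case: sL2 => W [_ FL _]; exact: FL.
have [i F1E] := facet_wall n2 h_data fF1;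
  have [j F2E] := facet_wall n2 h_data fF2.
rewrite F1E in sL1 F12 *; rewrite F2E in sL2 F12 *.
rewrite (wall_hyperplane n2 h_data p_space p_on sL1).
rewrite (wall_hyperplane n2 h_data p_space p_on sL2).
move=> [y [[yX yi] [_ yj]]].
have [x [xP xi xj]] := walls_meet h_data zP.1 z_lt obt yX yi yj.
by exists x.
Qed.
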